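(* Let $\kappa$ be a regular cardinal in a universe $\mathbf{U}$ and let $\mathbf{U}^+$ be a universe with $\mathbf{U} \subseteq \mathbf{U}^+$. If $i : \mathcal{C} \to \mathcal{C}^+$ is a $(\kappa,\mathbf{U},\mathbf{U}^+)$-accessible extension and $\mathcal{C}$ is a locally $\kappa$-presentable $\mathbf{U}$-category, then $i$ preserves colimits for all $\mathbf{U}$-small diagrams in $\mathcal{C}$.
   Context: A pre-universe is a set $\mathbf{U}$ such that: if $x \in y$ and $y \in \mathbf{U}$ then $x \in \mathbf{U}$; if $x, y \in \mathbf{U}$ then $\{x,y\} \in \mathbf{U}$; if $x \in \mathbf{U}$ then the power set of $x$ is in $\mathbf{U}$; if $x \in \mathbf{U}$ and $f : x \to \mathbf{U}$ is a map then $\bigcup_{t \in x} f(t) \in \mathbf{U}$. A universe is a pre-universe containing $\omega$ as a member. All categories are sets (models of the theory of categories inside set theory). A category is $\mathbf{U}$-small if its sets of objects and morphisms are members of $\mathbf{U}$; it is locally $\mathbf{U}$-small if its sets of objects and morphisms are subsets of $\mathbf{U}$ and all its hom-sets are members of $\mathbf{U}$. A $\mathbf{U}$-small diagram is a functor from a $\mathbf{U}$-small category. Let $\kappa$ be a regular cardinal in a universe $\mathbf{U}$. An object $A$ of a category $\mathcal{C}$ is $(\kappa,\mathbf{U})$-compact if $\mathrm{Hom}_{\mathcal{C}}(A,-)$, regarded as a functor to a sufficiently large category of sets, preserves colimits of all $\mathbf{U}$-small $\kappa$-filtered diagrams; $\mathbf{K}_\kappa^{\mathbf{U}}(\mathcal{C})$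 denotes the full subcategory of $(\kappa,\mathbf{U})$-compact objects. A $\kappa$-accessible $\mathbf{U}$-category is a locally $\mathbf{U}$-small category $\mathcal{C}$ that has colimits for all $\mathbf{U}$-small $\kappa$-filtered diagrams and for which there is a set $\mathcal{G} \in \mathbf{U}$ of $(\kappa,\mathbf{U})$-compact objects such that every object of $\mathcal{C}$ is a colimit of a $\mathbf{U}$-small $\kappa$-filtered diagram of objects in $\mathcal{G}$. A locally $\kappa$-presentable $\mathbf{U}$-category is a $\kappa$-accessible $\mathbf{U}$-category having colimits for all $\mathbf{U}$-small diagrams. A $(\kappa,\mathbf{U})$-accessible functor is a functor whose domain is a $\kappa$-accessible $\mathbf{U}$-category and which preserves colimits of all $\mathbf{U}$-small $\kappa$-filtered diagrams. Let $\mathbf{U}^+$ be a universe with $\mathbf{U} \subseteq \mathbf{U}^+$. A $(\kappa,\mathbf{U},\mathbf{U}^+)$-accessible extension is a $(\kappa,\mathbf{U})$-accessible functor $i : \mathcal{C} \to \mathcal{C}^+$ such that $\mathcal{C}$ is a $\kappa$-accessible $\mathbf{U}$-category, $\mathcal{C}^+$ is a $\kappa$-accessible $\mathbf{U}^+$-category, $i$ sends $(\kappa,\mathbf{U})$-compact objects of $\mathcal{C}$ to $(\kappa,\mathbf{U}^+)$-compact objects of $\mathcal{C}^+$, and the induced functor $\mathbf{K}_\kappa^{\mathbf{U}}(\mathcal{C}) \to \mathbf{K}_\kappa^{\mathbf{U}^+}(\mathcal{C}^+)$ is fully faithful and essentially surjective on objects. *)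

(* Defs.v *)
From HB Require Import structures.
From mathcomp Require Import all_boot boolp.

Set Implicit Arguments.
Unset Strict Implicit.
Unset Printing Implicit Defensive.

Declare Scope zf_scope.
Delimit Scope zf_scope with ZF.
Local Open Scope quotient_scope.
Local Open Scope zf_scope.

(** * Sets *)

(** The ambient set theory is Aczel's model: well-founded trees modulo
    bisimulation.  Passing to the quotient [V] makes extensionality hold for
    Leibniz equality. *)

Inductive tree : Type := Sup (A : Type) (f : A -> tree).

Fixpoint bisim (s t : tree) : Prop :=
  match s, t with
  | Sup A f, Sup B g =>
      (forall i, exists j, bisim (f i) (g j)) /\
      (forall j, exists i, bisim (f i) (g j))
  end.

Lemma bisim_refl s : bisim s s.
Proof. by elim: s => A f IH; split=> i; exists i. Qed.

Lemma bisim_sym s t : bisim s t -> bisim t s.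
Proof.
elim: s t => A f IH [B g] [fg gf]; split.
- by move=> j; have [i /IH] := gf j; exists i.
- by move=> i; have [j /IH] := fg i; exists j.
Qed.

Lemma bisim_trans t s u : bisim s t -> bisim t u -> bisim s u.
Proof.
elim: t s u => B g IH [A f] [K h] [fg gf] [gh hg]; split.
- move=> i; have [j fgj] := fg i; have [k ghk] := gh j.
  by exists k; apply: IH fgj ghk.
- move=> k; have [j ghj] := hg k; have [i fgi] := gf j.
  by exists i; apply: IH fgi ghj.
Qed.

HB.instance Definition _ := gen_eqMixin tree.
HB.instance Definition _ := gen_choiceMixin tree.

Definition bisimb : rel tree := fun s t => `[< bisim s t >].

Lemma bisimb_refl : reflexive bisimb.
Proof. by move=> s; apply/asboolP/bisim_refl. Qed.

Lemma bisimb_sym : symmetric bisimb.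
Proof. by move=> s t; apply/asboolP/asboolP; apply: bisim_sym. Qed.

Lemma bisimb_trans : transitive bisimb.
Proof.
by move=> t s u /asboolP st /asboolP tu; apply/asboolP/(bisim_trans st tu).
Qed.

Canonical bisim_equiv := EquivRel bisimb bisimb_refl bisimb_sym bisimb_trans.

Definition V := {eq_quot bisim_equiv}.

Lemma pi_bisim s t : \pi_V s = \pi_V t <-> bisim s t.
Proof.
split=> [/eqP|st]; last by apply/eqP; rewrite piE; apply/asboolP.
by rewrite piE => /asboolP.
Qed.

(** Every set [x] is the range of the family [elt x], whose index type [idx x]
    lives in the universe over which [tree] is built. *)
Definition idx (x : V) : Type := let: Sup A _ := repr x in A.

Definition elt (x : V) : idx x -> V :=
  match repr x as t return (let: Sup A _ := t in A) -> V with
  | Sup A f => fun i => \pi_V (f i)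
  end.

Definition memV (y x : V) : Prop := exists i : idx x, y = elt i.

Notation "y ∈ x" := (memV y x) (at level 70, no associativity) : zf_scope.

Definition subV (x y : V) : Prop := forall z, z ∈ x -> z ∈ y.

Notation "x ⊆ y" := (subV x y) (at level 70, no associativity) : zf_scope.

(** [family_set f] is the set of the [f i] for [i : A]. *)
Definition family_set (A : Type) (f : A -> V) : V :=
  \pi_V (Sup (fun i => repr (f i))).

Lemma mem_pi y A (f : A -> tree) :
  y ∈ \pi_V (Sup f) <-> exists i, y = \pi_V (f i).
Proof.
rewrite /memV /elt /idx.
have: bisim (repr (\pi_V (Sup f))) (Sup f) by apply/pi_bisim; rewrite reprK.
case: (repr _) => B g [gf fg]; split.
- by case=> j ->; have [i /pi_bisim] := gf j; exists i.
- by case=> i ->; have [j /pi_bisim] := fg i; exists j.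
Qed.

Lemma mem_family_set y A (f : A -> V) :
  y ∈ family_set f <-> exists i, y = f i.
Proof. by rewrite mem_pi; split=> -[i ->]; exists i; rewrite reprK. Qed.

Lemma zf_ext x y : (forall z, z ∈ x <-> z ∈ y) -> x = y.
Proof.
rewrite -[x]reprK -[y]reprK; case: (repr x) (repr y) => [A f] [B g] eq_xy.
apply/pi_bisim; split.
- move=> i; have /eq_xy/mem_pi[j /pi_bisim fg] : \pi_V (f i) ∈ \pi_V (Sup f).
    by apply/mem_pi; exists i.
  by exists j.
- move=> j; have /eq_xy/mem_pi[i /pi_bisim gf] : \pi_V (g j) ∈ \pi_V (Sup g).
    by apply/mem_pi; exists j.
  by exists i; apply: bisim_sym.
Qed.

Lemma mem_ind (P : V -> Prop) :
  (forall x, (forall y, y ∈ x -> P y) -> P x) -> forall x, P x.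
Proof.
move=> Pind x; rewrite -[x]reprK; elim: (repr x) => A f IH.
by apply: Pind => y /mem_pi[i ->].
Qed.

(** The type of elements of a set. *)
Definition El (x : V) : Type := {y : V | y ∈ x}.

Definition El_val (x : V) (t : El x) : V := sval t.
Coercion El_val : El >-> V.

Lemma elt_mem (x : V) (i : idx x) : elt i ∈ x.
Proof. by exists i. Qed.

Definition elE (x : V) (i : idx x) : El x := exist _ (elt i) (elt_mem i).

Definition sep (x : V) (P : V -> Prop) : V :=
  family_set (fun i : {i : idx x | P (elt i)} => elt (sval i)).

Lemma mem_sep y x P : y ∈ sep x P <-> y ∈ x /\ P y.
Proof.
rewrite mem_family_set; split.
  by case=> -[i Pi] ->; split; first by exists i.
by case=> -[i ->] Pi; exists (exist _ i Pi).
Qed.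

Definition pair_set (x y : V) : V :=
  family_set (fun b : bool => if b then x else y).

Lemma mem_pair_set z x y : z ∈ pair_set x y <-> z = x \/ z = y.
Proof.
rewrite mem_family_set; split; first by case=> -[] ->; [left|right].
by case=> ->; [exists true|exists false].
Qed.

Definition power_set (x : V) : V := family_set (fun P : idx x -> Prop =>
  family_set (fun i : {i | P i} => elt (sval i))).

Lemma mem_power_set y x : y ∈ power_set x <-> y ⊆ x.
Proof.
rewrite mem_family_set; split.
  by case=> P -> z /mem_family_set[[i Pi] ->]; exists i.
move=> yx; exists (fun i => elt i ∈ y); apply: zf_ext => z; rewrite mem_family_set.
split; last by case=> -[i yi] ->.
by move=> zy; have [i zi] := yx z zy; subst z; exists (exist _ i zy).
Qed.

Definition big_union (x : V) (f : El x -> V) : V :=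
  family_set (fun p : {i : idx x & idx (f (elE i))} => elt (projT2 p)).

Lemma mem_big_union y x (f : El x -> V) :
  y ∈ big_union f <-> exists t : El x, y ∈ f t.
Proof.
rewrite mem_family_set; split; first by case=> -[i j] ->; exists (elE i), j.
case=> -[t ti]; have [i def_t] := ti; subst t.
by rewrite (Prop_irrelevance ti (elt_mem i)) => -[j ->]; exists (existT _ i j).
Qed.

Definition succ_set (x : V) : V :=
  family_set (fun o : option (idx x) => if o is Some i then elt i else x).

Lemma mem_succ_set y x : y ∈ succ_set x <-> y ∈ x \/ y = x.
Proof.
rewrite mem_family_set; split; first by case=> -[i|] ->; [left; exists i|right].
by case=> [[i ->]|->]; [exists (Some i)|exists None].
Qed.

Fixpoint nat_set (n : nat) : V :=
  if n is m.+1 then succ_set (nat_set m)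
  else family_set (fun v : Empty_set => match v with end).

Definition omega : V := family_set nat_set.

(** * Universes and regular cardinals *)

Record pre_universe (U : V) : Prop := PreUniverse {
  pre_universe_trans : forall x y, x ∈ y -> y ∈ U -> x ∈ U;
  pre_universe_pair : forall x y, x ∈ U -> y ∈ U -> pair_set x y ∈ U;
  pre_universe_power : forall x, x ∈ U -> power_set x ∈ U;
  pre_universe_union : forall x (f : El x -> V),
    x ∈ U -> (forall t, f t ∈ U) -> big_union f ∈ U
}.

Definition universe (U : V) : Prop := pre_universe U /\ omega ∈ U.

Definition transitive_set (x : V) : Prop := forall y, y ∈ x -> y ⊆ x.

Definition ordinal (a : V) : Prop :=
  transitive_set a /\ forall b, b ∈ a -> transitive_set b.

Definition injects (x y : V) : Prop := exists f : El x -> El y, injective f.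

Definition cardinal (k : V) : Prop :=
  ordinal k /\ forall a, a ∈ k -> ~ injects k a.

(** Infinite, and no map from a smaller ordinal to [k] is cofinal. *)
Definition regular_cardinal (k : V) : Prop :=
  [/\ cardinal k, omega ⊆ k &
      forall a (f : El a -> El k), a ∈ k ->
        exists2 b, b ∈ k & forall t, f t ∈ b].

(** The cardinality of [x] is less than the cardinal [k]. *)
Definition card_lt (x k : V) : Prop := exists2 a, a ∈ k & injects x a.

(** * Categories *)

Record cat_structure (obj : Type) (hom : obj -> obj -> Type) := CatStructure {
  cat_id : forall A, hom A A;
  cat_comp : forall A B C, hom B C -> hom A B -> hom A C;
  cat_compm1 : forall A B (f : hom A B), cat_comp f (cat_id A) = f;
  cat_comp1m : forall A B (f : hom A B), cat_comp (cat_id B) f = f;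
  cat_compA : forall A B C D (h : hom C D) (g : hom B C) (f : hom A B),
    cat_comp h (cat_comp g f) = cat_comp (cat_comp h g) f
}.

(** Possibly large categories.  They are needed only to accommodate the category
    of all sets; the categories one reasons about are the [setcat] below. *)
Record category := Category {
  obj :> Type;
  hom : obj -> obj -> Type;
  category_structure : cat_structure hom
}.

Definition idm (C : category) (A : C) : hom A A :=
  cat_id (category_structure C) A.

Definition compm (C : category) (X Y Z : C) (g : hom Y Z) (f : hom X Y) :
  hom X Z := cat_comp (category_structure C) g f.

Notation "g ∘ f" := (compm g f) (at level 40, left associativity) : zf_scope.

Record quiver := Quiver {
  Ob : V;
  Mor : V;
  dom : El Mor -> El Ob;
  cod : El Mor -> El Ob
}.

Definition homset (Q : quiver) (A B : El (Ob Q)) : V :=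
  sep (Mor Q) (fun f =>
    exists m : El (Mor Q), [/\ f = m, dom m = A & cod m = B]).

(** Categories that are sets.  A function between types of the form [El x] is
    the same thing as a set-theoretic function, by replacement. *)
Record setcat := SetCat {
  setcat_quiver :> quiver;
  setcat_structure :
    cat_structure (fun A B : El (Ob setcat_quiver) => El (homset A B))
}.

Definition category_of_setcat (C : setcat) : category :=
  Category (setcat_structure C).
Coercion category_of_setcat : setcat >-> category.

Record functor (C D : category) := Functor {
  fobj :> C -> D;
  fmap : forall A B : C, hom A B -> hom (fobj A) (fobj B);
  fmap1 : forall A : C, fmap (idm A) = idm (fobj A);
  fmapM : forall (X Y Z : C) (g : hom Y Z) (f : hom X Y),
    fmap (g ∘ f) = fmap g ∘ fmap f
}.

Section FunctorComp.
Variables (B C D : category) (G : functor C D) (F : functor B C).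

Lemma functor_comp1 (X : B) : fmap G (fmap F (idm X)) = idm (G (F X)).
Proof. by rewrite !fmap1. Qed.

Lemma functor_compM (X Y Z : B) (g : hom Y Z) (f : hom X Y) :
  fmap G (fmap F (g ∘ f)) = fmap G (fmap F g) ∘ fmap G (fmap F f).
Proof. by rewrite !fmapM. Qed.

Definition functor_comp : functor B D :=
  @Functor B D (fun X => G (F X)) (fun X Y f => fmap G (fmap F f))
    functor_comp1 functor_compM.

End FunctorComp.

Definition isomorphic (C : category) (A B : C) : Prop :=
  exists (f : hom A B) (g : hom B A), g ∘ f = idm A /\ f ∘ g = idm B.

Definition fully_faithful (C D : category) (F : functor C D) : Prop :=
  forall A B : C, bijective (@fmap C D F A B).

Definition essentially_surjective (C D : category) (F : functor C D) : Prop :=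
  forall B : D, exists A : C, isomorphic (F A) B.

Section FullSubcategory.
Variables (C : category) (P : C -> Prop).

Definition full_hom (A B : {A : C | P A}) : Type := hom (sval A) (sval B).

Definition full_structure : cat_structure full_hom :=
  @CatStructure _ full_hom
    (fun A => idm (sval A)) (fun X Y Z g f => g ∘ f)
    (fun _ _ f => cat_compm1 (category_structure C) f)
    (fun _ _ f => cat_comp1m (category_structure C) f)
    (fun _ _ _ _ h g f => cat_compA (category_structure C) h g f).

Definition full_subcategory : category := Category full_structure.

End FullSubcategory.

Section InducedFunctor.
Variables (C D : category) (P : C -> Prop) (Q : D -> Prop) (F : functor C D).
Hypothesis FPQ : forall A, P A -> Q (F A).

Definition induced_functor :
    functor (full_subcategory P) (full_subcategory Q) :=
  @Functor (full_subcategory P) (full_subcategory Q)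
    (fun A => exist _ (F (sval A)) (FPQ (svalP A)))
    (fun A B f => fmap F f)
    (fun A => fmap1 F (sval A))
    (fun X Y Z g f => fmapM F (g : hom (sval Y) (sval Z)) f).

End InducedFunctor.

(** ** Colimits *)

Record cocone (J C : category) (D : functor J C) := Cocone {
  apex : C;
  leg : forall j : J, hom (D j) apex;
  legP : forall (j j' : J) (u : hom j j'), leg j' ∘ fmap D u = leg j
}.

Definition is_colimit (J C : category) (D : functor J C) (c : cocone D) : Prop :=
  forall c' : cocone D, exists! u : hom (apex c) (apex c'),
    forall j, u ∘ leg c j = leg c' j.

Section MapCocone.
Variables (J C C' : category) (F : functor C C') (D : functor J C).
Variable c : cocone D.

Lemma map_cocone_legP (j j' : J) (u : hom j j') :
  fmap F (leg c j') ∘ fmap (functor_comp F D) u = fmap F (leg c j).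
Proof. by rewrite /= -fmapM legP. Qed.

Definition map_cocone : cocone (functor_comp F D) :=
  @Cocone J C' (functor_comp F D) (F (apex c)) (fun j => fmap F (leg c j))
    map_cocone_legP.

End MapCocone.

Definition preserves_colimit (J C C' : category) (F : functor C C')
    (D : functor J C) : Prop :=
  forall c : cocone D, is_colimit c -> is_colimit (map_cocone F c).

Definition has_colimit (J C : category) (D : functor J C) : Prop :=
  exists c : cocone D, is_colimit c.

(** ** Hom functors *)

(** The category of all sets, which contains every hom-set of every [setcat]. *)
Definition SetV : category :=
  @Category V (fun x y => El x -> El y)
    (@CatStructure V (fun x y => El x -> El y)
      (fun _ t => t) (fun _ _ _ g f t => g (f t))
      (fun _ _ _ => erefl) (fun _ _ _ => erefl) (fun _ _ _ _ _ _ _ => erefl)).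

Section HomFunctor.
Variables (C : setcat) (A : C).

Definition hom_functor_map (X Y : C) (g : hom X Y) :
    El (homset A X) -> El (homset A Y) :=
  fun f => (g : hom X Y) ∘ (f : hom (A : C) X).

Lemma hom_functor1 (X : C) :
  hom_functor_map (idm X) = idm (homset A X : SetV).
Proof. by apply/funext => f; apply: cat_comp1m. Qed.

Lemma hom_functorM (X Y Z : C) (g : hom Y Z) (f : hom X Y) :
  hom_functor_map (g ∘ f) =
  compm (C := SetV) (hom_functor_map g) (hom_functor_map f).
Proof. by apply/funext => h; symmetry; apply: cat_compA. Qed.

Definition hom_functor : functor C SetV :=
  @Functor C SetV (homset A) hom_functor_map hom_functor1 hom_functorM.

End HomFunctor.

(** * Accessible categories *)

Definition small (U : V) (C : setcat) : Prop := Ob C ∈ U /\ Mor C ∈ U.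

Definition locally_small (U : V) (C : setcat) : Prop :=
  [/\ Ob C ⊆ U, Mor C ⊆ U & forall A B : C, homset A B ∈ U].

(** Every diagram with fewer than [k] arrows in [J] has a cocone. *)
Definition filtered (k : V) (J : category) : Prop :=
  forall (I : setcat) (D : functor I J),
    card_lt (Mor I) k -> inhabited (cocone D).

Definition compact (k U : V) (C : setcat) (A : C) : Prop :=
  forall (J : setcat) (D : functor J C),
    small U J -> filtered k J -> preserves_colimit (hom_functor A) D.

Definition compacts (k U : V) (C : setcat) : category :=
  full_subcategory (@compact k U C).

Definition accessible_category (k U : V) (C : setcat) : Prop :=
  [/\ locally_small U C,
      forall (J : setcat) (D : functor J C),
        small U J -> filtered k J -> has_colimit D &
      exists G : V,
        [/\ G ∈ U, G ⊆ Ob C, forall A : C, El_val A ∈ G -> compact k U A &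
            forall A : C, exists (J : setcat) (D : functor J C) (c : cocone D),
              [/\ small U J, filtered k J, forall j, El_val (D j) ∈ G,
                  is_colimit c & apex c = A]]].

Definition locally_presentable (k U : V) (C : setcat) : Prop :=
  accessible_category k U C /\
  forall (J : setcat) (D : functor J C), small U J -> has_colimit D.

Definition accessible_functor (k U : V) (C D : setcat) (F : functor C D) :
    Prop :=
  accessible_category k U C /\
  forall (J : setcat) (X : functor J C),
    small U J -> filtered k J -> preserves_colimit F X.

Record accessible_extension (k U U' : V) (C C' : setcat) (i : functor C C') :
    Prop := AccessibleExtension {
  ext_functor : accessible_functor k U i;
  ext_source : accessible_category k U C;
  ext_target : accessible_category k U' C';
  ext_compact : forall A : C, compact k U A -> compact k U' (i A);
  ext_ff : fully_faithful
    (induced_functor ext_compact : functor (compacts k U C) (compacts k U' C'));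
  ext_eso : essentially_surjective
    (induced_functor ext_compact : functor (compacts k U C) (compacts k U' C'))
}.

(* Main.v *)
From Stdlib Require Import Eqdep Program.Equality.
From mathcomp Require Import all_boot boolp.
Require Import Defs.

Set Implicit Arguments.
Unset Strict Implicit.
Unset Printing Implicit Defensive.

Local Open Scope zf_scope.

(** Let [G] be a small set of compact generators.  A colimit of [D] is also the
    colimit of the comma quiver of [D], whose vertices are the maps [B -> D j]
    with [B] in [G], because every [D j] is a colimit of objects of [G].  That
    colimit is in turn the [kappa]-filtered colimit, over the [kappa]-small
    subquivers [S], of the colimits [K S], and [i] preserves it by accessibility.
    So it is enough that [i] preserves [kappa]-small colimits of compact objects.
    An object of [C'] is a [kappa]-filtered colimit of compact objects, each
    isomorphic to some [i B] with [B] compact; a cocone on a [kappa]-small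
    diagram of compact objects factors through one stage of it, and there it
    comes from a cocone in [C] because [i] is fully faithful on compact objects. *)

(** * Smallness of types *)

Lemma El_inj (x : V) : injective (@El_val x).
Proof. by move=> s t; apply: eq_sig_hprop => ? ? ?; apply: Prop_irrelevance. Qed.

Definition to_El (x y : V) (yx : y ∈ x) : El x := exist _ y yx.

Lemma El_mem (x : V) (t : El x) : El_val t ∈ x.
Proof. by case: t. Qed.

Lemma mem_irrefl (x : V) : ~ x ∈ x.
Proof. by move: x; apply: mem_ind => x IH xx; apply: (IH x). Qed.

Lemma dependent_choice (A : Type) (B : A -> Type) (P : forall a, B a -> Prop) :
  (forall a, exists b, P a b) -> exists f, forall a, P a (f a).
Proof. by move=> /(_ _)/cid pP; exists (fun a => sval (pP a)) => a; case: (pP a). Qed.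

(** Smallness is tested by injections, so that it applies to arbitrary index types. For a cardinal
    [W] it means cardinality below [W]; for a universe [W], being at most as large as some
    member. *)
Definition small_in (W : V) (A : Type) : Prop :=
  exists2 x, x ∈ W & exists f : A -> El x, injective f.

Lemma small_inj (W : V) (A B : Type) (f : A -> B) :
  injective f -> small_in W B -> small_in W A.
Proof. by move=> fI [x xW [g gI]]; exists x => //; exists (g \o f); apply: inj_comp. Qed.

Lemma small_surj (W : V) (A B : Type) (f : A -> B) :
  (forall b, exists a, f a = b) -> small_in W A -> small_in W B.
Proof.
move=> /choice[g fg]; apply: (small_inj (f := g)).
by move=> b b' /(congr1 f); rewrite !fg.
Qed.

Lemma small_El (W x : V) : x ∈ W -> small_in W (El x).
Proof. by move=> xW; exists x => //; exists id. Qed.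

(** The closure properties common to regular cardinals and universes, so that one set of counting
    lemmas serves both. *)
Definition small_sums (W : V) : Prop :=
  small_in W bool /\
  forall (A : Type) (B : A -> Type), small_in W A ->
    (forall a, small_in W (B a)) -> small_in W {a : A & B a}.

Section SmallSums.
Variables (W : V) (sumW : small_sums W).

Lemma small_sig (A : Type) (P : A -> Prop) : small_in W A -> small_in W {a | P a}.
Proof.
apply: (small_inj (f := sval)) => a b; apply: eq_sig_hprop => ? ? ?.
exact: Prop_irrelevance.
Qed.

Lemma small_Prop (P : Prop) : small_in W P.
Proof.
apply: (small_inj (f := fun=> true)); last by case: sumW.
by move=> p q _; apply: Prop_irrelevance.
Qed.

Lemma small_prod (A B : Type) : small_in W A -> small_in W B -> small_in W (A * B).
Proof.
move=> sA sB; apply: (@small_surj _ {a : A & B} _ (fun s => (projT1 s, projT2 s))).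
  by case=> a b; exists (existT _ a b).
exact: sumW.2.
Qed.

Lemma small_sum (A B : Type) : small_in W A -> small_in W B -> small_in W (A + B).
Proof.
move=> sA sB; pose F (b : bool) := if b then A else B.
pose f (s : {b : bool & F b}) : A + B :=
  match s with existT true a => inl a | existT false b => inr b end.
apply: (small_surj (f := f)); last by apply: sumW.2; [case: sumW | case].
by case=> [a|b]; [exists (existT F true a)|exists (existT F false b)].
Qed.

Lemma small_void (A : Type) : (A -> False) -> small_in W A.
Proof.
move=> A0; apply: (small_inj (f := fun=> true)); last by case: sumW.
by move=> a; case: (A0 a).
Qed.

End SmallSums.

Lemma zero_in_two : nat_set 0 ∈ nat_set 2.
Proof. by apply/mem_succ_set; left; apply/mem_succ_set; right. Qed.

Lemma one_in_two : nat_set 1 ∈ nat_set 2.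
Proof. by apply/mem_succ_set; right. Qed.

Definition bool_El (b : bool) : El (nat_set 2) :=
  if b then to_El one_in_two else to_El zero_in_two.

Lemma bool_El_inj : injective bool_El.
Proof.
have neq : nat_set 0 <> nat_set 1.
  move=> e01; apply: (@mem_irrefl (nat_set 0)); rewrite {2}e01.
  by apply/mem_succ_set; right.
by case=> -[] // /(congr1 (@El_val _)) // /esym.
Qed.

Lemma small_bool (W : V) : nat_set 2 ∈ W -> small_in W bool.
Proof. by move=> W2; exists (nat_set 2) => //; exists bool_El; apply: bool_El_inj. Qed.

Lemma two_in_omega : nat_set 2 ∈ omega.
Proof. by apply/mem_family_set; exists 2. Qed.

(** ** Regular cardinals *)

Lemma mem_wf : well_founded memV.
Proof. by apply: mem_ind => x IH; constructor. Qed.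

Lemma mem_ordinal (a b : V) : ordinal a -> b ∈ a -> ordinal b.
Proof.
by move=> [atr btr] ba; split; [exact: btr|move=> c cb; apply/btr/(atr b)].
Qed.

(** Double induction on membership. If neither ordinal is equal to or in a member of the other, the
    induction hypotheses force both to have the same elements. *)
Lemma ordinal_trichotomy (a b : V) :
  ordinal a -> ordinal b -> [\/ a ∈ b, a = b | b ∈ a].
Proof.
move: a b; apply: mem_ind => a IHa; apply: mem_ind => b IHb oa ob.
have [[b' b'b]|nb] := pselect (exists2 b', b' ∈ b & a = b' \/ a ∈ b').
  by case=> [->|ab']; apply: Or31 => //; apply: ob.1 ab'.
have [[a' a'a]|na] := pselect (exists2 a', a' ∈ a & a' = b \/ b ∈ a').
  by case=> [<-|ba']; apply: Or33 => //; apply: oa.1 ba'.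
apply: Or32; apply: zf_ext => c; split=> [ca|cb].
  have [|cb|bc] := IHa c ca b (mem_ordinal oa ca) ob => //.
    by case: na; exists c => //; left.
  by case: na; exists c => //; right.
have [ac|ac|] := IHb c cb oa (mem_ordinal ob cb) => //.
  by case: nb; exists c => //; right.
by case: nb; exists c => //; left.
Qed.

(* Enumerate [A] along [k] without repetition; the enumeration stops before
   exhausting [k], since otherwise [k] would inject into [A]. *)
Lemma small_or_injects (k : V) (A : Type) :
  ordinal k -> small_in k A \/ exists f : El k -> A, injective f.
Proof.
move=> ok.
pose avoid (x : V) (g : forall y, y ∈ x -> option A) : A -> Prop :=
  fun a => forall y (yx : y ∈ x), g y yx <> Some a.
pose step (x : V) (g : forall y, y ∈ x -> option A) : option A :=
  if pselect (exists a, avoid x g a) is left ex then Some (sval (cid ex)) else None.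
pose e := Fix mem_wf (fun=> option A) step.
have eE x : e x = step x (fun y _ => e y).
  rewrite /e Fix_eq // => {}x g h gh; congr (step x _).
  by apply: functional_extensionality_dep => y; apply: funext => yx; apply: gh.
have e_new x y a : y ∈ x -> e x = Some a -> e y <> Some a.
  move=> yx; rewrite eE /step; case: pselect => // ex [<-].
  by case: (cid ex) => b /= /(_ y yx).
have e_out x : e x = None -> forall a, exists2 y, y ∈ x & e y = Some a.
  rewrite eE /step; case: pselect => // nex _ a.
  have /existsNP[y /existsNP[yx /contrapT ya]] : ~ avoid x (fun y _ => e y) a.
    by move=> Aa; apply: nex; exists a.
  by exists y.
pose F (t : El k) := e t.
case: (pselect (exists t, F t = None)) => [[t /e_out out]|allS].
  (* Nothing new is left at [t], so every element of [A] was listed at some member of [t]; choosing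
     such an index is injective. *)
  left; exists t; first exact: El_mem.
  have /choice[f fP] : forall a, exists y : El t, e y = Some a.
    by move=> a; have [y yt ya] := out a; exists (to_El yt).
  by exists f => a b fab; have := fP a; rewrite fab fP => -[].
right; have /choice[f fP] : forall t : El k, exists a, F t = Some a.
  move=> t; case E: (F t) => [a|]; first by exists a.
  by case: allS; exists t.
exists f => s t fst.
have et : e t = Some (f t) := fP t.
have es : e s = Some (f t) by rewrite -fst; apply: fP.
have [st|/El_inj //|ts] :=
  ordinal_trichotomy (mem_ordinal ok (El_mem s)) (mem_ordinal ok (El_mem t)).
  by case: (e_new _ _ _ st et).
by case: (e_new _ _ _ ts es).
Qed.

Section Regular.
Variables (k : V) (regular_k : regular_cardinal k).

Let ordinal_k : ordinal k. Proof. by case: regular_k => -[]. Qed.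

Let bounded (a : V) (f : El a -> El k) :
  a ∈ k -> exists2 b : El k, True & forall t, f t ∈ b.
Proof.
by case: regular_k => _ _ reg /(reg _ f)[b bk fb]; exists (to_El bk).
Qed.

(* Both coordinates are bounded below [k]: first for a fixed left component,
   then over all of them, so that the bound itself has no preimage. *)
Lemma regular_not_injects_prod (a b : V) (h : El k -> El a * El b) :
  a ∈ k -> b ∈ k -> ~ injective h.
Proof.
move=> ak bk hI; pose a0 : El k := to_El ak.
(* [E] inverts [h] on its image; the default [a0] only makes it total. *)
pose E (t : El a) (s : El b) : El k :=
  if pselect (exists c, h c = (t, s)) is left ex then sval (cid ex) else a0.
have EP c t s : h c = (t, s) -> E t s = c.
  move=> hc; rewrite /E; case: pselect => [ex|[]]; last by exists c.
  by apply: hI; case: (cid ex) => /= ? ->.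
have /choice[p pP] t : exists p : El k, forall s, E t s ∈ p.
  by have [p _ pP] := bounded (E t) bk; exists p.
have [q _ qP] := bounded p ak.
(* Since [q] is the [E]-value at [h q], it lies in [p (h q).1], which lies in [q]; transitivity
   gives [q ∈ q]. *)
have := pP (h q).1 (h q).2; rewrite (EP q) -?surjective_pairing // => qp.
have := qP (h q).1 => pq; apply: (@mem_irrefl q).
exact: ((mem_ordinal ordinal_k (El_mem q)).1 _ pq).
Qed.

(** Regularity bounds the sizes of all [B a] by one [b ∈ k], so the sum injects into [x] times [b].
    Were it not small, [k] would inject into it and hence into that product. *)
Lemma regular_small_sums : small_sums k.
Proof.
split.
  by apply: small_bool; case: regular_k => _ /(_ _ two_in_omega).
move=> A B [x xk [f fI]] sB.
have /choice[y yP] a : exists y : El k, exists g : B a -> El y, injective g.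
  by have [y yk gP] := sB a; exists (to_El yk).
have [g gI] := dependent_choice yP.
(* [F] extends [y] along the injection [f]; the default off its image is [x], itself a member of
   [k]. *)
pose F (t : El x) : El k :=
  if pselect (exists a, f a = t) is left ex then y (sval (cid ex))
  else to_El xk.
have [b _ Fb] := bounded F xk.
have yb a : y a ∈ b.
  have := Fb (f a); rewrite /F; case: pselect => [ex|[]]; last by exists a.
  by case: (cid ex) => /= a' /fI ->.
have ysub a (t : El (y a)) : t ∈ b.
  exact: (mem_ordinal ordinal_k (El_mem b)).1 (yb a) _ (El_mem t).
pose h (s : {a : A & B a}) : El x * El b :=
  (f (projT1 s), to_El (ysub _ (g _ (projT2 s)))).
have hI : injective h.
  move=> [a u] [a' u'] [/fI aa']; subst a'; move/El_inj/gI => -> //.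
have [//|[h' h'I]] := @small_or_injects k {a : A & B a} ordinal_k.
by case: (@regular_not_injects_prod x b (h \o h') xk (El_mem b)); apply: inj_comp.
Qed.

End Regular.

(** ** Universes *)

Definition ordered_pair (x y : V) : V := pair_set (pair_set x x) (pair_set x y).

Lemma pair_set_xx_inj (x y z : V) : pair_set x x = pair_set y z -> x = y /\ x = z.
Proof.
move=> e; have xE t : t ∈ pair_set y z -> t = x.
  by rewrite -e => /mem_pair_set[].
by split; symmetry; apply/xE/mem_pair_set; [left|right].
Qed.

Lemma ordered_pair_inj (x y x' y' : V) :
  ordered_pair x y = ordered_pair x' y' -> x = x' /\ y = y'.
Proof.
move=> e.
have xx' : x = x'.
  have : pair_set x x ∈ ordered_pair x' y'.
    by rewrite -e; apply/mem_pair_set; left.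
  by case/mem_pair_set => /pair_set_xx_inj[].
subst x'; split=> //.
have : pair_set x y ∈ ordered_pair x y' by rewrite -e; apply/mem_pair_set; right.
have : pair_set x y' ∈ ordered_pair x y by rewrite e; apply/mem_pair_set; right.
case/mem_pair_set => [/esym/pair_set_xx_inj[_ <-]|e1].
  by case/mem_pair_set => /esym/pair_set_xx_inj[].
move=> _.
have : y ∈ pair_set x y' by rewrite e1; apply/mem_pair_set; right.
have : y' ∈ pair_set x y by rewrite -e1; apply/mem_pair_set; right.
by case/mem_pair_set => -> //; case/mem_pair_set.
Qed.

Section Universe.
Variables (U : V) (universe_U : universe U).

Let pre_U : pre_universe U. Proof. by case: universe_U. Qed.

Lemma universe_sub (x y : V) : x ⊆ y -> y ∈ U -> x ∈ U.
Proof.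
move=> xy /(pre_universe_power pre_U); apply: (pre_universe_trans pre_U).
exact/mem_power_set.
Qed.

(** An element of the sum is coded by the ordered pair of its codes, which lies in the double power
    set of [Z], the union of [x] and of all the [y a]. *)
Lemma universe_small_sums : small_sums U.
Proof.
split.
  apply: small_bool; apply: (pre_universe_trans pre_U two_in_omega).
  by case: universe_U.
move=> A B [x xU [f fI]] sB.
have /choice[y yP] a : exists y : El U, exists g : B a -> El y, injective g.
  by have [y yU gP] := sB a; exists (to_El yU).
have [g gI] := dependent_choice yP.
pose F (t : El x) : V :=
  if pselect (exists a, f a = t) is left ex then y (sval (cid ex)) else x.
have FU t : F t ∈ U.
  by rewrite /F; case: pselect => // ex; apply: El_mem.
have yF a : F (f a) = y a.
  rewrite /F; case: pselect => [ex|[]]; last by exists a.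
  by case: (cid ex) => /= a' /fI ->.
pose Y := big_union F.
have YU : Y ∈ U by apply: pre_universe_union.
pose Z := big_union (fun t : El (pair_set x Y) => El_val t).
have ZU : Z ∈ U.
  apply: pre_universe_union => //; first exact: pre_universe_pair.
  by move=> [t /= /mem_pair_set[] ->].
have inZ z : z ∈ x \/ z ∈ Y -> z ∈ Z.
  case=> zt; apply/mem_big_union.
    have xp : x ∈ pair_set x Y by apply/mem_pair_set; left.
    by exists (to_El xp).
  have Yp : Y ∈ pair_set x Y by apply/mem_pair_set; right.
  by exists (to_El Yp).
pose h (s : {a : A & B a}) := ordered_pair (f (projT1 s)) (g _ (projT2 s)).
have hZ s : h s ∈ power_set (power_set Z).
  have fZ : El_val (f (projT1 s)) ∈ Z by apply: inZ; left; apply: El_mem.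
  have gZ : El_val (g _ (projT2 s)) ∈ Z.
    apply: inZ; right; apply/mem_big_union; exists (f (projT1 s)).
    by rewrite yF; apply: El_mem.
  apply/mem_power_set => u /mem_pair_set uP; apply/mem_power_set => v.
  by case: uP => -> /mem_pair_set[] ->.
exists (power_set (power_set Z)); first by do 2 apply: (pre_universe_power pre_U).
exists (fun s => to_El (hZ s)) => -[a u] [a' u'] /(congr1 (@El_val _)).
rewrite /= /h => /ordered_pair_inj[/El_inj/fI /= aa'].
by subst a' => /= /El_inj/gI ->.
Qed.

(** This bounds the number of subquivers of a small quiver, which are given by pairs of
    predicates. *)
Lemma universe_small_pred (A : Type) : small_in U A -> small_in U (A -> Prop).
Proof.
move=> [x xU [f fI]]; exists (power_set x); first exact: pre_universe_power.
pose h (P : A -> Prop) := sep x (fun v => exists2 a, P a & v = f a).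
have hx P : h P ∈ power_set x by apply/mem_power_set => v /mem_sep[].
exists (fun P => to_El (hx P)) => P Q /(congr1 (@El_val _)) /= hPQ.
have hE R a : R a <-> El_val (f a) ∈ h R.
  split=> [Ra|/mem_sep[_ [b Rb /El_inj/fI ->]] //].
  by apply/mem_sep; split; [exact: El_mem|exists a].
by apply/funext => a; apply/propext; rewrite hE hPQ -hE.
Qed.

End Universe.

Lemma small_trans (k W : V) (A : Type) :
  pre_universe W -> k ∈ W -> small_in k A -> small_in W A.
Proof. by move=> pW kW [x xk fP]; exists x => //; apply: pre_universe_trans xk kW. Qed.

(** * Diagrams over quivers *)

Section CategoryLaws.
Variable C : category.

Lemma compmA (X Y Z T : C) (h : hom Z T) (g : hom Y Z) (f : hom X Y) :
  h ∘ (g ∘ f) = h ∘ g ∘ f.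
Proof. exact: cat_compA. Qed.

Lemma compm1 (X Y : C) (f : hom X Y) : f ∘ idm X = f.
Proof. exact: cat_compm1. Qed.

Lemma comp1m (X Y : C) (f : hom X Y) : idm Y ∘ f = f.
Proof. exact: cat_comp1m. Qed.

End CategoryLaws.

(* Diagrams are indexed by a quiver [E] on [Q]; a functor [D] is the case
   [E := hom], [m := fmap D]. *)
Section Diagram.
Variables (C : category) (Q : Type) (E : Q -> Q -> Type) (X : Q -> C).
Variable m : forall x y, E x y -> hom (X x) (X y).
Arguments m {x y} _.

Definition compatible (A : C) (n : forall x, hom (X x) A) : Prop :=
  forall x y (e : E x y), n y ∘ m e = n x.

Definition universal (A : C) (n : forall x, hom (X x) A) : Prop :=
  compatible n /\ forall (B : C) (p : forall x, hom (X x) B),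
    compatible p -> exists! h : hom A B, forall x, h ∘ n x = p x.

Lemma compatible_comp (A B : C) (n : forall x, hom (X x) A) (h : hom A B) :
  compatible n -> compatible (fun x => h ∘ n x).
Proof. by move=> cn x y e; rewrite -compmA cn. Qed.

Lemma universal_eq (A B : C) (n : forall x, hom (X x) A) (g h : hom A B) :
  universal n -> (forall x, g ∘ n x = h ∘ n x) -> g = h.
Proof.
move=> [cn un] gh; have [k [_ ku]] := un _ _ (compatible_comp h cn).
by rewrite -(ku g gh) -(ku h).
Qed.

Lemma universal_ex (A B : C) (n : forall x, hom (X x) A) (p : forall x, hom (X x) B) :
  universal n -> compatible p -> exists h : hom A B, forall x, h ∘ n x = p x.
Proof. by move=> [_ un] /un[h [hP _]]; exists h. Qed.

Lemma universalI (A : C) (n : forall x, hom (X x) A) :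
  compatible n ->
  (forall (B : C) (p : forall x, hom (X x) B), compatible p ->
     exists h : hom A B, forall x, h ∘ n x = p x) ->
  (forall (B : C) (g h : hom A B), (forall x, g ∘ n x = h ∘ n x) -> g = h) ->
  universal n.
Proof.
move=> cn ex eq; split=> // B p /ex[h hP]; exists h; split=> // h' h'P.
by apply: eq => x; rewrite hP h'P.
Qed.

End Diagram.

Lemma compatible_leg (J C : category) (D : functor J C) (c : cocone D) :
  compatible (fmap D) (leg c).
Proof. by move=> x y u; apply: legP. Qed.

Lemma is_colimitE (J C : category) (D : functor J C) (c : cocone D) :
  is_colimit c <-> universal (fmap D) (leg c).
Proof.
split=> [cc|[_ uc] c']; last exact/uc/compatible_leg.
by split=> [|B p cp]; [exact: compatible_leg|exact: (cc (Cocone cp))].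
Qed.

Definition arrow (Q : Type) (E : Q -> Q -> Type) : Type := {x : Q & {y : Q & E x y}}.

Lemma small_arrow (W : V) (Q : Type) (E : Q -> Q -> Type) :
  small_sums W -> small_in W Q -> (forall x y, small_in W (E x y)) ->
  small_in W (arrow E).
Proof. by move=> sW sQ sE; do 2 apply: sW.2 => // ?. Qed.

Lemma small_objects (W : V) (J : category) :
  small_in W (arrow (@hom J)) -> small_in W J.
Proof.
apply: (@small_surj _ _ _ (fun a : arrow (@hom J) => projT1 a)) => X.
by exists (existT _ X (existT _ X (idm X))).
Qed.

(** ** Set-sized models of small categories *)

Section SetcatModel.
Variables (J : category) (x y : V).
Variables (f : J -> El x) (g : arrow (@hom J) -> El y).
Hypotheses (f_inj : injective f) (g_inj : injective g).

Let ob : V := sep x (fun v => exists X, v = f X).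
Let mo : V := sep y (fun v => exists a, v = g a).

Let f_ob (X : J) : El_val (f X) ∈ ob.
Proof. by apply/mem_sep; split; [apply: El_mem|exists X]. Qed.

Let g_mo (a : arrow (@hom J)) : El_val (g a) ∈ mo.
Proof. by apply/mem_sep; split; [apply: El_mem|exists a]. Qed.

Let code (X : J) : El ob := to_El (f_ob X).
Let codem (a : arrow (@hom J)) : El mo := to_El (g_mo a).

Let code_surj (A : El ob) : exists X, code X = A.
Proof.
have /mem_sep[_ [X AX]] := El_mem A.
by exists X; apply: El_inj; rewrite AX.
Qed.

Let codem_surj (m : El mo) : exists a, codem a = m.
Proof.
have /mem_sep[_ [a ma]] := El_mem m.
by exists a; apply: El_inj; rewrite ma.
Qed.

Let decode (A : El ob) : J := sval (cid (code_surj A)).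
Let decodem (m : El mo) : arrow (@hom J) := sval (cid (codem_surj m)).

Let decodeK (A : El ob) : code (decode A) = A.
Proof. by rewrite /decode; case: cid. Qed.

Let codeK (X : J) : decode (code X) = X.
Proof. by have /(congr1 (@El_val _)) /= /El_inj/f_inj := decodeK (code X). Qed.

Let decodemK (m : El mo) : codem (decodem m) = m.
Proof. by rewrite /decodem; case: cid. Qed.

Let codemK (a : arrow (@hom J)) : decodem (codem a) = a.
Proof. by have /(congr1 (@El_val _)) /= /El_inj/g_inj := decodemK (codem a). Qed.

Let Qv : quiver := @Quiver ob mo (fun m => code (projT1 (decodem m)))
  (fun m => code (projT1 (projT2 (decodem m)))).

Let of_hom_mem (A B : El ob) (h : hom (decode A) (decode B)) :
  El_val (codem (existT _ _ (existT _ _ h))) ∈ @homset Qv A B.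
Proof.
apply/mem_sep; split; first exact: El_mem.
by eexists; split; first reflexivity; rewrite /= codemK decodeK.
Qed.

Let of_hom (A B : El ob) (h : hom (decode A) (decode B)) : El (@homset Qv A B) :=
  to_El (of_hom_mem h).

Let of_hom_inj (A B : El ob) : injective (@of_hom A B).
Proof.
move=> h h' /(congr1 (@El_val _)) /= /El_inj/g_inj.
by move=> e; apply: inj_pair2 (inj_pair2 _ _ _ _ _ e).
Qed.

Let of_hom_surj (A B : El ob) (t : El (@homset Qv A B)) : exists h, of_hom h = t.
Proof.
have /mem_sep[_ [m [tm dm cm]]] := El_mem t.
move: (decodemK m) dm cm; rewrite /=.
case: (decodem m) => X [Y h] /= gm fX fY; subst A B.
(* [decode (code X)] equals [X] only propositionally, so [h] is carried across inside the total type
   of arrows. *)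
suff [h' h'E] : exists h' : hom (decode (code X)) (decode (code Y)),
    existT _ _ (existT _ _ h') = existT _ X (existT _ Y h) :> arrow (@hom J).
  by exists h'; apply: El_inj; rewrite tm -gm /= h'E.
by rewrite !codeK; exists h.
Qed.

Let to_hom (A B : El ob) (t : El (@homset Qv A B)) : hom (decode A) (decode B) :=
  sval (cid (of_hom_surj t)).

Let to_homK (A B : El ob) (t : El (@homset Qv A B)) : of_hom (to_hom t) = t.
Proof. by rewrite /to_hom; case: cid. Qed.

Let of_homK (A B : El ob) (h : hom (decode A) (decode B)) : to_hom (of_hom h) = h.
Proof. by apply: of_hom_inj; rewrite to_homK. Qed.

Let structure : cat_structure (fun A B : El (Ob Qv) => El (homset A B)).
Proof.
apply: (@CatStructure _ _ (fun A => of_hom (idm (decode A)))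
  (fun A B C s t => of_hom (to_hom s ∘ to_hom t))).
- by move=> A B t; rewrite of_homK compm1 to_homK.
- by move=> A B t; rewrite of_homK comp1m to_homK.
- by move=> A B C D u s t; rewrite !of_homK compmA.
Defined.

Let S : setcat := SetCat structure.

Let model_map1 (A : S) : to_hom (idm A) = idm (decode A).
Proof. exact: of_homK. Qed.

Let model_mapM (A B C : S) (s : hom B C) (t : hom A B) :
  to_hom (s ∘ t) = to_hom s ∘ to_hom t.
Proof. exact: of_homK. Qed.

(** Objects and arrows are replaced by their codes in [x] and [y]. Full faithfulness and
    surjectivity on objects are what the transfer of colimits and filteredness uses. *)
Lemma setcat_model : exists (S : setcat) (T : functor S J),
  [/\ Ob S ⊆ x, Mor S ⊆ y, fully_faithful T & forall X, exists A, T A = X].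
Proof.
exists S, (@Functor S J decode to_hom model_map1 model_mapM); split.
- by move=> v /mem_sep[].
- by move=> v /mem_sep[].
- by move=> A B; exists (@of_hom A B); [exact: to_homK|exact: of_homK].
- by move=> X; exists (code X); apply: codeK.
Qed.

End SetcatModel.

(** * Restriction along a fully faithful functor surjective on objects *)

Section Restriction.
Variables (S J : category) (T : functor S J).
Hypotheses (T_ff : fully_faithful T) (T_surj : forall X, exists A, T A = X).

Lemma extend_compatible (C : category) (D : functor J C) (B : C)
    (n : forall s, hom (D (T s)) B) :
  compatible (fmap (functor_comp D T)) n ->
  exists2 n' : forall X, hom (D X) B,
    compatible (fmap D) n' & forall s, n' (T s) = n s.
Proof.
move=> cn.
(* The equality [T s = X] is remembered only as a retraction of [T s] onto [X], which avoids
   transport along it. *)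
have /dependent_choice[r rP] X : exists p : {s : S & hom X (T s) * hom (T s) X}%type,
    (projT2 p).2 ∘ (projT2 p).1 = idm X.
  have [s <-] := T_surj X.
  by exists (existT _ s (idm _, idm _)); apply: compm1.
have full (A A' : S) (u : hom (T A) (T A')) : exists v, fmap T v = u.
  by have [k _ kK] := T_ff A A'; exists (k u).
exists (fun X => n (projT1 (r X)) ∘ fmap D (projT2 (r X)).1).
  move=> X Y u /=.
  (* Conjugating [u] with the chosen maps gives an arrow between objects [T s], which lifts to [S]
     by fullness. *)
  have [v vE] := full _ _ ((projT2 (r Y)).1 ∘ u ∘ (projT2 (r X)).2).
  rewrite -(cn _ _ v) /= vE -!compmA -!fmapM -!compmA rP.
  by rewrite compm1.
move=> s /=; have [v <-] := full _ _ (projT2 (r (T s))).1.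
exact: cn.
Qed.

(** Cocones over the restriction and over [D] correspond: they extend by [extend_compatible], and
    they are determined by their legs at the objects [T s], which are all objects. *)
Lemma universal_restrict (C : category) (D : functor J C) (A : C)
    (n : forall X, hom (D X) A) : compatible (fmap D) n ->
  universal (fmap (functor_comp D T)) (fun s => n (T s)) <-> universal (fmap D) n.
Proof.
move=> cn; have cT B (p : forall X, hom (D X) B) : compatible (fmap D) p ->
    compatible (fmap (functor_comp D T)) (fun s => p (T s)).
  by move=> cp s s' u; apply: cp.
split=> un; apply: universalI => //.
- move=> B p cp; have [h hP] := universal_ex un (cT _ _ cp).
  by exists h => X; have [s <-] := T_surj X; apply: hP.
- by move=> B g h gh; apply: universal_eq un _ => s; apply: gh.
- exact: cT.
- move=> B p cp; have [p' cp' p'E] := extend_compatible cp.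
  have [h hP] := universal_ex un cp'.
  by exists h => s; rewrite hP p'E.
- move=> B g h gh; apply: universal_eq un _ => X.
  by have [s <-] := T_surj X; apply: gh.
Qed.

End Restriction.

Definition small_category (W : V) (J : category) : Prop :=
  small_in W (arrow (@hom J)).

Lemma small_category_model (U : V) (J : category) :
  universe U -> small_category U J -> exists (S : setcat) (T : functor S J),
    [/\ small U S, fully_faithful T & forall X, exists A, T A = X].
Proof.
move=> uU sJ; have [x xU [f fI]] := small_objects sJ; have [y yU [g gI]] := sJ.
have [S [T [Sx Sy Tff Ts]]] := setcat_model fI gI.
by exists S, T; split=> //; split; [apply: universe_sub Sx xU|apply: universe_sub Sy yU].
Qed.

Lemma lt_category_model (k : V) (J : category) :
  small_category k J -> exists (S : setcat) (T : functor S J),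
    [/\ card_lt (Mor S) k, fully_faithful T & forall X, exists A, T A = X].
Proof.
move=> sJ; have [x xk [f fI]] := small_objects sJ; have [y yk [g gI]] := sJ.
have [S [T [_ Sy Tff Ts]]] := setcat_model fI gI.
exists S, T; split=> //; exists y => //.
exists (fun t => to_El (Sy _ (El_mem t))) => s t /(congr1 (@El_val _)) /=.
exact: El_inj.
Qed.

(** ** Quivers as categories *)

(* A quiver becomes a category without nontrivial composites once every arrow
   [e] is turned into an object with maps to its source and its target.  A
   diagram sends the first of them to an identity. *)
Section Subdivision.
Variables (Q : Type) (E : Q -> Q -> Type).

Inductive subdivision_hom : Q + arrow E -> Q + arrow E -> Type :=
| Sub_id a : subdivision_hom a a
| Sub_src x y (e : E x y) :
    subdivision_hom (inr (existT _ x (existT _ y e))) (inl x)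
| Sub_tgt x y (e : E x y) :
    subdivision_hom (inr (existT _ x (existT _ y e))) (inl y).

(** Only the identity maps into an arrow vertex, so composing after a source or target map returns
    that map. The [unit] branches fill the impossible cases. *)
Definition subdivision_comp a b c (g : subdivision_hom b c) :
  subdivision_hom a b -> subdivision_hom a c :=
  match g in subdivision_hom b c return subdivision_hom a b -> subdivision_hom a c with
  | Sub_id _ => id
  | Sub_src x y e => fun f =>
      match f in subdivision_hom a b return
        match b with
        | inl _ => unit
        | inr e => subdivision_hom a (inl (projT1 e))
        end with
      | Sub_id (inl _) => tt
      | Sub_id (inr (existT x (existT y e))) => Sub_src e
      | _ => tt
      end
  | Sub_tgt x y e => fun f =>
      match f in subdivision_hom a b return
        match b with
        | inl _ => unit
        | inr e => subdivision_hom a (inl (projT1 (projT2 e)))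
        end with
      | Sub_id (inl _) => tt
      | Sub_id (inr (existT x (existT y e))) => Sub_tgt e
      | _ => tt
      end
  end.

Lemma subdivision_compA a b c d (h : subdivision_hom c d)
    (g : subdivision_hom b c) (f : subdivision_hom a b) :
  subdivision_comp h (subdivision_comp g f) = subdivision_comp (subdivision_comp h g) f.
Proof.
case: h g => [//|x y e|x y e] g.
  by dependent destruction g.
by dependent destruction g.
Qed.

Definition subdivision : category := Category (@CatStructure _ subdivision_hom
  Sub_id subdivision_comp
  (fun a b f => match f with
   | Sub_id _ => erefl | Sub_src _ _ _ => erefl | Sub_tgt _ _ _ => erefl end)
  (fun _ _ _ => erefl) subdivision_compA).

Variables (C : category) (X : Q -> C) (m : forall x y, E x y -> hom (X x) (X y)).

Definition subdivision_ob (a : subdivision) : C :=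
  match a with inl x => X x | inr e => X (projT1 e) end.

Definition subdivision_map (a b : subdivision) (f : hom a b) :
    hom (subdivision_ob a) (subdivision_ob b) :=
  match f in subdivision_hom a b return hom (subdivision_ob a) (subdivision_ob b) with
  | Sub_id a => idm _
  | Sub_src x y e => idm (X x)
  | Sub_tgt x y e => m e
  end.

Lemma subdivision_mapM (a b c : subdivision)
    (g : subdivision_hom b c) (f : subdivision_hom a b) :
  subdivision_map (subdivision_comp g f) = subdivision_map g ∘ subdivision_map f.
Proof.
case: g f => [?|x y e|x y e] f /=; first by rewrite comp1m.
  by dependent destruction f; rewrite compm1.
by dependent destruction f; rewrite compm1.
Qed.

Definition subdivision_functor : functor subdivision C :=
  @Functor subdivision C subdivision_ob subdivision_map (fun=> erefl) subdivision_mapM.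

Definition subdivision_leg (A : C) (n : forall x, hom (X x) A) (a : subdivision) :
    hom (subdivision_ob a) A :=
  match a with inl x => n x | inr e => n (projT1 e) end.

Lemma subdivision_compatible (A : C) (n : forall x, hom (X x) A) :
  compatible m n -> compatible (fmap subdivision_functor) (subdivision_leg n).
Proof.
move=> cn; suff cL a b (f : subdivision_hom a b) :
    subdivision_leg n b ∘ subdivision_map f = subdivision_leg n a by exact: cL.
by case: a b / f => [a|x y e|x y e] /=; rewrite ?compm1 ?cn.
Qed.

Lemma compatible_subdivision (A : C) (p : forall a, hom (subdivision_ob a) A) :
  compatible (fmap subdivision_functor) p -> compatible m (fun x => p (inl x)).
Proof.
move=> cp x y e; rewrite (cp _ _ (Sub_tgt e)).
by rewrite -(cp _ _ (Sub_src e)) /= compm1.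
Qed.

(** The leg at an arrow vertex is forced to be the leg at its source, so the subdivision and the
    quiver have the same cocones. *)
Lemma universal_subdivision (A : C) (p : forall a, hom (subdivision_ob a) A) :
  universal (fmap subdivision_functor) p -> universal m (fun x => p (inl x)).
Proof.
move=> up; have cp := up.1.
apply: universalI => [|B q cq|B g h gh]; first exact: compatible_subdivision.
  have [h hP] := universal_ex up (subdivision_compatible cq).
  by exists h => x; apply: (hP (inl x)).
apply: universal_eq up _ => -[x|[x [y e]]]; first exact: gh.
by rewrite -(cp _ _ (Sub_src e)) /= compm1; apply: gh.
Qed.

Lemma small_subdivision (W : V) : small_sums W -> small_in W Q ->
  small_in W (arrow E) -> small_category W subdivision.
Proof.
move=> sW sQ sE.
pose f (s : (Q + arrow E) + (arrow E * bool)) : arrow (@hom subdivision) :=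
  match s with
  | inl a => existT _ a (existT _ a (Sub_id a))
  | inr (existT x (existT y e), true) => existT _ _ (existT _ _ (Sub_src e))
  | inr (existT x (existT y e), false) => existT _ _ (existT _ _ (Sub_tgt e))
  end.
have f_surj a b (g : subdivision_hom a b) :
    exists s, f s = existT _ a (existT _ b g).
  case: a b / g => [c|x y e|x y e]; first by exists (inl c).
    by exists (inr (existT _ x (existT _ y e), true)).
  by exists (inr (existT _ x (existT _ y e), false)).
apply: (small_surj (f := f)) => [[a [b g]]|]; first exact: f_surj.
apply: small_sum => //; first exact: small_sum.
by apply: small_prod => //; case: sW.
Qed.

End Subdivision.

(** ** Filteredness, cocompleteness and preservation for quiver diagrams *)

(** Filteredness tested on quivers over arbitrary types, the form in which cocones are requested
    below. Subdivision and coding by sets relate it to [filtered]. *)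
Definition quiver_filtered (k : V) (J : category) : Prop :=
  forall (Q : Type) (E : Q -> Q -> Type) (X : Q -> J)
      (m : forall x y, E x y -> hom (X x) (X y)),
    small_in k Q -> small_in k (arrow E) ->
    exists (A : J) (n : forall x, hom (X x) A), compatible m n.

Lemma filtered_quiver (k : V) (J : category) :
  small_sums k -> filtered k J -> quiver_filtered k J.
Proof.
move=> sk fJ Q E X m sQ sE.
have [S [T [Sk Tff Ts]]] := lt_category_model (small_subdivision sk sQ sE).
have [c] := fJ S (functor_comp (subdivision_functor m) T) Sk.
have [n cn _] := extend_compatible Tff Ts (compatible_leg c).
by exists (apex c), (fun x => n (inl x)); apply: compatible_subdivision cn.
Qed.

(** The hom-sets are disjoint subsets of [Mor I]: [dom] and [cod] recover the endpoints from the
    morphism. *)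
Lemma setcat_arrowE (I : setcat) (a b : arrow (@hom I)) :
  El_val (projT2 (projT2 a)) = El_val (projT2 (projT2 b)) -> a = b.
Proof.
case: a b => [A [B f]] [A' [B' f']] /= ff'.
have /mem_sep[_ [m [fm dm cm]]] := El_mem f.
have /mem_sep[_ [m' [fm' dm' cm']]] := El_mem f'.
have mm' : m = m' by apply: El_inj; rewrite -fm -fm'.
by subst m' A A' B B'; rewrite (El_inj ff').
Qed.

Lemma small_setcat (W : V) (I : setcat) :
  small_in W (El (Mor I)) -> small_category W I.
Proof.
have fM (A B : El (Ob I)) (f : El (homset A B)) : El_val f ∈ Mor I.
  by have /mem_sep[] := El_mem f.
apply: (small_inj (f := fun a => to_El (fM _ _ (projT2 (projT2 a))))).
by move=> a b /(congr1 (@El_val _)) /= /setcat_arrowE.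
Qed.

Lemma small_category_of_small (U : V) (I : setcat) : small U I -> small_category U I.
Proof. by move=> [_ IU]; apply/small_setcat/small_El. Qed.

Lemma quiver_filtered_model (k : V) (J S : category) (T : functor S J) :
  small_sums k ->
  fully_faithful T -> (forall X, exists A, T A = X) ->
  quiver_filtered k J -> filtered k S.
Proof.
move=> sk Tff Ts fJ I D sI.
have {}sI : small_category k I by apply: small_setcat; case: sI => a; exists a.
have [A [n cn]] := fJ _ _ _ (fmap (functor_comp T D)) (small_objects sI) sI.
have [s sA] := Ts A; subst A.
have /dependent_choice[l lP] i : exists v, fmap T v = n i.
  by have [k' _ k'K] := Tff (D i) s; exists (k' (n i)).
constructor; apply: (@Cocone _ _ _ s l) => i j u.
by apply: (bij_inj (Tff _ _)); rewrite fmapM !lP; apply: cn.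
Qed.

Lemma has_quiver_colimit (U : V) (C : category) :
  universe U ->
  (forall (J : setcat) (D : functor J C), small U J -> has_colimit D) ->
  forall (Q : Type) (E : Q -> Q -> Type) (X : Q -> C)
      (m : forall x y, E x y -> hom (X x) (X y)),
    small_in U Q -> small_in U (arrow E) ->
    exists (A : C) (n : forall x, hom (X x) A), universal m n.
Proof.
move=> uU cC Q E X m sQ sE.
have sU := universe_small_sums uU.
have [S [T [SU Tff Ts]]] := small_category_model uU (small_subdivision sU sQ sE).
have [c /is_colimitE uc] := cC S (functor_comp (subdivision_functor m) T) SU.
have [n cn nE] := extend_compatible Tff Ts (compatible_leg c).
exists (apex c), (fun x => n (inl x)); apply: universal_subdivision.
apply/(universal_restrict Tff Ts cn).
by have -> : (fun s => n (T s)) = leg c by apply: functional_extensionality_dep.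
Qed.

(** The preservation hypothesis speaks of set categories, so [P] is replaced by a coded model and
    the colimit is carried there and back. *)
Lemma preserves_filtered_universal (k U : V) (C C' : category) (F : functor C C') :
  universe U -> small_sums k ->
  (forall (J : setcat) (X : functor J C),
    small U J -> filtered k J -> preserves_colimit F X) ->
  forall (P : category) (D : functor P C) (A : C) (n : forall p, hom (D p) A),
    small_category U P -> quiver_filtered k P -> universal (fmap D) n ->
    universal (fmap (functor_comp F D)) (fun p => fmap F (n p)).
Proof.
move=> uU sk pF P D A n sP fP un.
have [S [T [SU Tff Ts]]] := small_category_model uU sP.
have /(universal_restrict Tff Ts un.1) uS := un.
have cS : compatible (fmap (functor_comp D T)) (fun s => n (T s)) := uS.1.
apply/(universal_restrict Tff Ts).
  by move=> p q u /=; rewrite -fmapM un.1.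
have cc : is_colimit (Cocone cS) by apply/is_colimitE.
by have /is_colimitE := pF S _ SU (quiver_filtered_model sk Tff Ts fP) _ cc.
Qed.

(** * Compact objects *)

(* For a filtered diagram, these two conditions say that
   Hom(A, -) preserves the colimit. *)
Definition factors_through (J C : category) (D : functor J C) (c : cocone D) (A : C) :
    Prop :=
  forall f : hom A (apex c), exists (j : J) (g : hom A (D j)), leg c j ∘ g = f.

Definition equalized (J C : category) (D : functor J C) (c : cocone D) (A : C) :
    Prop :=
  forall (j j' : J) (g : hom A (D j)) (g' : hom A (D j')),
    leg c j ∘ g = leg c j' ∘ g' ->
    exists (l : J) (u : hom j l) (u' : hom j' l), fmap D u ∘ g = fmap D u' ∘ g'.

Definition presented (J C : category) (D : functor J C) (c : cocone D) (A : C) : Prop :=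
  factors_through c A /\ equalized c A.

(** * Lifting maps and equations to stages of a filtered diagram *)

Section Filtered.
Variables (k : V) (J : category).
Hypotheses (sk : small_sums k) (fJ : quiver_filtered k J).

Lemma filtered_bound (Q : Type) (X : Q -> J) :
  small_in k Q -> exists (l : J), inhabited (forall q, hom (X q) l).
Proof.
move=> sQ; have sE : small_in k (arrow (fun _ _ : Q => False)).
  by apply: small_arrow => // *; apply: (small_Prop sk).
have [l [n _]] := @fJ Q _ X (fun _ _ e => False_rect _ e) sQ sE.
by exists l.
Qed.

Lemma filtered_join (j j' : J) :
  exists (l : J), inhabited (hom j l * hom j' l).
Proof.
have [l [n]] := filtered_bound (fun b : bool => if b then j else j') sk.1.
by exists l; constructor; split; [exact: (n true)|exact: (n false)].
Qed.

(** Two parallel arrows, told apart by the boolean, from one source to every [Some q]; a cocone on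
    it coequalizes all these pairs at once. *)
Inductive fan (Q : Type) : option Q -> option Q -> Type :=
| Fan (b : bool) (q : Q) : fan None (Some q).

Lemma filtered_coequalize (Q : Type) (j : J) (X : Q -> J) (u v : forall q, hom j (X q)) :
  small_in k Q -> exists (l : J) (w : hom j l) (t : forall q, hom (X q) l),
    forall q, t q ∘ u q = w /\ t q ∘ v q = w.
Proof.
move=> sQ; pose Y (o : option Q) := if o is Some q then X q else j.
pose m o o' (e : fan o o') : hom (Y o) (Y o') :=
  match e in fan o o' return hom (Y o) (Y o') with
  | Fan b q => if b then u q else v q
  end.
have so : small_in k (option Q).
  have s1 := small_Prop sk True.
  apply: (@small_surj _ (True + Q) _ (fun s => if s is inr q then Some q else None)).
    by case=> [q|]; [exists (inr q)|exists (inl I)].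
  exact: small_sum.
have sE : small_in k (arrow (@fan Q)).
  apply: (@small_surj _ (bool * Q) _ (fun s => existT _ _ (existT _ _ (Fan s.1 s.2)))).
    by move=> [_ [_ [b q]]]; exists (b, q).
  by apply: small_prod => //; apply: sk.1.
have [l [n cn]] := fJ m so sE.
exists l, (n None), (fun q => n (Some q)) => q.
by split; [apply: (cn _ _ (Fan true q))|apply: (cn _ _ (Fan false q))].
Qed.

(** One cospan for each arrow of the quiver, joining its two endpoints at a vertex that stands for
    the arrow. *)
Inductive incidence (Q : Type) (E : Q -> Q -> Type) :
    Q + arrow E -> Q + arrow E -> Type :=
| Inc_src x y (e : E x y) : incidence (inl x) (inr (existT _ x (existT _ y e)))
| Inc_tgt x y (e : E x y) : incidence (inl y) (inr (existT _ x (existT _ y e))).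

Lemma filtered_cospans (Q : Type) (E : Q -> Q -> Type) (X : Q -> J)
    (Y : forall x y, E x y -> J) (s : forall x y (e : E x y), hom (X x) (Y x y e))
    (t : forall x y (e : E x y), hom (X y) (Y x y e)) :
  small_in k Q -> small_in k (arrow E) ->
  exists (l : J) (n : forall x, hom (X x) l) (p : forall x y (e : E x y), hom (Y x y e) l),
    forall x y (e : E x y), p x y e ∘ s x y e = n x /\ p x y e ∘ t x y e = n y.
Proof.
move=> sQ sE.
pose Z (a : Q + arrow E) : J :=
  match a with inl x => X x | inr (existT x (existT y e)) => Y x y e end.
pose m a b (i : incidence a b) : hom (Z a) (Z b) :=
  match i in incidence a b return hom (Z a) (Z b) with
  | Inc_src x y e => s x y e
  | Inc_tgt x y e => t x y e
  end.
have sI : small_in k (arrow (@incidence Q E)).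
  pose f (a : arrow E * bool) : arrow (@incidence Q E) :=
    match a with
    | (existT x (existT y e), true) => existT _ _ (existT _ _ (Inc_src e))
    | (existT x (existT y e), false) => existT _ _ (existT _ _ (Inc_tgt e))
    end.
  apply: (small_surj (f := f)).
    move=> [_ [_ [x y e|x y e]]].
      by exists (existT _ x (existT _ y e), true).
    by exists (existT _ x (existT _ y e), false).
  by apply: small_prod => //; apply: sk.1.
have [l [n cn]] := fJ m (small_sum sk sQ sE) sI.
exists l, (fun x => n (inl x)), (fun x y e => n (inr (existT _ x (existT _ y e)))).
by move=> x y e; split; [apply: (cn _ _ (Inc_src e))|apply: (cn _ _ (Inc_tgt e))].
Qed.

Variables (C : category) (D : functor J C) (c : cocone D).

(** Each [x] has its own stage, reached by two possibly different maps out of [j]; coequalizing all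
    these pairs at once gives one [w]. *)
Lemma equalized_stage (Q : Type) (X : Q -> C) (j : J) (p q : forall x, hom (X x) (D j)) :
  small_in k Q -> (forall x, equalized c (X x)) ->
  (forall x, leg c j ∘ p x = leg c j ∘ q x) ->
  exists (l : J) (w : hom j l), forall x, fmap D w ∘ p x = fmap D w ∘ q x.
Proof.
move=> sQ eX pq.
have /choice[l lP] x : exists l, exists uv : hom j l * hom j l,
    fmap D uv.1 ∘ p x = fmap D uv.2 ∘ q x.
  by have [l [u [v uv]]] := eX x _ _ _ _ (pq x); exists l, (u, v).
have [uv uvP] := dependent_choice lP.
have [l' [w [t tP]]] := filtered_coequalize (fun x => (uv x).1) (fun x => (uv x).2) sQ.
exists l', w => x; have [uw vw] := tP x.
by rewrite -[in LHS]uw -[in RHS]vw !fmapM -!compmA uvP.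
Qed.

(** Every [n x] lifts to some stage, and every arrow has a further stage where the lifts at its
    endpoints become compatible. These stages form a [k]-small diagram of cospans, over which there
    is a cocone. *)
Lemma presented_stage (Q : Type) (E : Q -> Q -> Type) (X : Q -> C)
    (m : forall x y, E x y -> hom (X x) (X y)) (n : forall x, hom (X x) (apex c)) :
  small_in k Q -> small_in k (arrow E) -> (forall x, presented c (X x)) ->
  compatible m n ->
  exists (j : J) (p : forall x, hom (X x) (D j)),
    compatible m p /\ forall x, leg c j ∘ p x = n x.
Proof.
move=> sQ sE pX cn.
have /choice[j /dependent_choice[g gP]] x :
    exists j, exists g : hom (X x) (D j), leg c j ∘ g = n x.
  exact: (pX x).1.
have /dependent_choice[Y YP] (a : arrow E) : exists Y,
    exists uv : hom (j (projT1 a)) Y * hom (j (projT1 (projT2 a))) Y,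
    fmap D uv.1 ∘ g _ = fmap D uv.2 ∘ (g _ ∘ m _ _ (projT2 (projT2 a))).
  case: a => x [y e] /=.
  have [|Y [u [v uv]]] := (pX x).2 _ _ (g x) (g y ∘ m _ _ e).
    by rewrite compmA !gP cn.
  by exists Y, (u, v).
have [uv uvP] := dependent_choice YP.
pose a x y e : arrow E := existT _ x (existT _ y e).
have [l [w [p pP]]] := @filtered_cospans Q E j (fun x y e => Y (a x y e))
  (fun x y e => (uv (a x y e)).1) (fun x y e => (uv (a x y e)).2) sQ sE.
exists l, (fun x => fmap D (w x) ∘ g x); split=> [x y e|x]; last first.
  by rewrite compmA legP gP.
have [<- <-] := pP x y e.
by rewrite !fmapM -!compmA; congr (_ ∘ _); rewrite (uvP (a x y e)).
Qed.

(** A map out of [A] is a compatible family, which [presented_stage] lifts to one stage. Two lifts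
    agree once they agree after every [n x], which [equalized_stage] arranges. *)
Lemma universal_presented (Q : Type) (E : Q -> Q -> Type) (X : Q -> C)
    (m : forall x y, E x y -> hom (X x) (X y)) (A : C) (n : forall x, hom (X x) A) :
  small_in k Q -> small_in k (arrow E) -> (forall x, presented c (X x)) ->
  universal m n -> presented c A.
Proof.
move=> sQ sE pX un; split=> [f|j j' g g' gg'].
  have [j [p [cp pP]]] := presented_stage sQ sE pX (compatible_comp f un.1).
  have [h hP] := universal_ex un cp.
  by exists j, h; apply: universal_eq un _ => x; rewrite -compmA hP.
have [l0 [[u u']]] := filtered_join j j'.
have [||l [w wP]] := @equalized_stage Q X l0
  (fun x => fmap D u ∘ (g ∘ n x)) (fun x => fmap D u' ∘ (g' ∘ n x)) sQ.
- by move=> x; apply: (pX x).2.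
- by move=> x; rewrite !compmA !legP gg'.
exists l, (w ∘ u), (w ∘ u'); apply: universal_eq un _ => x.
by rewrite !fmapM -!compmA; apply: wP.
Qed.

End Filtered.

(** * Compactness in terms of factorizations through stages *)

Section Compact.
Variables (k U : V) (C : setcat).
Hypothesis sk : small_sums k.

Let one : El (nat_set 2) := bool_El true.

(** The colimit of hom-sets is tested against two cocones into the two-element set of truth
    values. *)
Lemma compact_presented (A : C) (J : setcat) (D : functor J C) (c : cocone D) :
  small U J -> filtered k J -> compact k U A -> is_colimit c -> presented c A.
Proof.
move=> sJ fJ cA cc; have fJ' := filtered_quiver sk fJ.
have hc := cA J D sJ fJ c cc; split=> [f|j j' g g' gg'].
  (* Membership in the image of some leg and constant truth both factor the constant cocone, so
     uniqueness identifies them. *)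
  pose im (h : hom A (apex c)) := `[< exists j g, leg c j ∘ g = h >].
  pose c1 : cocone (functor_comp (hom_functor A) D) :=
    @Cocone _ SetV (functor_comp (hom_functor A) D) (nat_set 2)
      (fun _ _ => one) (fun _ _ _ => erefl).
  have [u [_ uu]] := hc c1.
  have E : (fun h => bool_El (im h)) = (fun _ => one).
    transitivity u; last by apply: uu.
    symmetry; apply: uu => j; apply/funext => g /=.
    by congr bool_El; apply/asboolP; exists j, g.
  have /bool_El_inj/asboolP := congr1 (fun F => F f) E.
  by [].
(* [eqv j0 h] says that [h] and [g] become equal at a later stage. It respects transition maps, so
   it factors through the apex, where [g] and [g'] have the same image. *)
pose eqv j0 (h : hom A (D j0)) := `[< exists l (v : hom j l) (w : hom j0 l),
  fmap D v ∘ g = fmap D w ∘ h >].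
have eqvP (j0 j1 : J) (u : hom j0 j1) :
    (fun h : hom A (D j0) => bool_El (eqv j1 (fmap D u ∘ h))) =
    (fun h => bool_El (eqv j0 h)).
  apply/funext => h; congr bool_El; apply/asboolP/asboolP.
    by move=> [l [v [w vw]]]; exists l, v, (w ∘ u); rewrite fmapM -compmA.
  move=> [l [v [w vw]]]; have [l0 [[a b]]] := filtered_join sk fJ' l j1.
  (* A single parallel pair is coequalized: the paths from [j0] to [l0] through [l] and through
     [j1]. *)
  have [l' [t [r /(_ I)[ra rb]]]] := filtered_coequalize sk fJ'
    (fun _ : True => a ∘ w) (fun=> b ∘ u) (small_Prop sk True).
  exists l', (r I ∘ a ∘ v), (r I ∘ b).
  by rewrite fmapM -compmA vw !compmA -!fmapM -!compmA ra rb.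
pose c2 : cocone (functor_comp (hom_functor A) D) :=
  @Cocone _ SetV (functor_comp (hom_functor A) D) (nat_set 2)
    (fun j0 h => bool_El (eqv j0 h)) eqvP.
have [u [uP _]] := hc c2.
have uE j0 (h : hom A (D j0)) : u (leg c j0 ∘ h) = bool_El (eqv j0 h).
  exact: (congr1 (fun F : El (homset A (D j0)) -> El (nat_set 2) => F h) (uP j0)).
have /bool_El_inj/asboolP : bool_El (eqv j' g') = bool_El true.
  rewrite -uE -gg' uE; congr bool_El; apply/asboolP.
  by exists j, (idm j), (idm j).
by [].
Qed.

(** The factorization sends [f] to the value of the test cocone on a chosen lift of [f]; [equalized]
    makes this value independent of the lift. *)
Lemma presented_compact (A : C) :
  (forall (J : setcat) (D : functor J C) (c : cocone D),
    small U J -> filtered k J -> is_colimit c -> presented c A) ->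
  compact k U A.
Proof.
move=> pA J D sJ fJ c cc t; have fJ' := filtered_quiver sk fJ.
have [fac eq] := pA J D c sJ fJ cc.
have /dependent_choice[j /dependent_choice[g gP]] f := fac f.
have legt j0 j1 (w : hom j0 j1) (h : hom A (D j0)) :
    leg t j1 (fmap D w ∘ h) = leg t j0 h.
  exact: (congr1 (fun F : El (homset A (D j0)) -> El (apex t) => F h) (legP t w)).
exists (fun f => leg t (j f) (g f)); split=> [j0|u uP].
  apply/funext => h; have [l [v [w vw]]] := eq _ _ _ _ (gP (leg c j0 ∘ h)).
  by rewrite -[RHS](legt _ _ w) -vw legt.
by apply/funext => f; rewrite -uP -[in RHS](gP f).
Qed.

End Compact.

Lemma compact_small_colimit (k U : V) (C : setcat) (Q : Type) (E : Q -> Q -> Type)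
    (X : Q -> C) (m : forall x y, E x y -> hom (X x) (X y))
    (A : C) (n : forall x, hom (X x) A) :
  small_sums k -> small_in k Q -> small_in k (arrow E) ->
  (forall x, compact k U (X x)) -> universal m n -> compact k U A.
Proof.
move=> sk sQ sE cX un; apply: presented_compact => // J D c sJ fJ cc.
apply: (universal_presented sk (filtered_quiver sk fJ) sQ sE _ un) => x.
exact: compact_presented (cX x) cc.
Qed.

(** * Extensions and [k]-small colimits of compact objects *)

Section ExtensionSmallColimit.
Variables (k U U' : V) (C C' : setcat) (i : functor C C').
Hypotheses (sk : small_sums k) (ext_i : accessible_extension k U U' i).

Let ff (A B : C) (cA : compact k U A) (cB : compact k U B) :
  bijective (@fmap _ _ i A B).
Proof.
exact: (ext_ff ext_i (exist _ A cA : compacts k U C) (exist _ B cB : compacts k U C)).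
Qed.

Let eso (B : C') : compact k U' B ->
  exists A : C, compact k U A /\ isomorphic (i A) B.
Proof.
move=> cB; have [[A cA] [f [g [gf fg]]]] :=
  ext_eso ext_i (exist _ B cB : compacts k U' C').
by exists A; split=> //; exists f, g.
Qed.

Variables (Q : Type) (E : Q -> Q -> Type) (X : Q -> C).
Variables (m : forall x y, E x y -> hom (X x) (X y)).
Variables (A : C) (n : forall x, hom (X x) A).
Hypotheses (sQ : small_in k Q) (sE : small_in k (arrow E)).
Hypotheses (cX : forall x, compact k U (X x)) (un : universal m n).

(** Full faithfulness of [i] is available only between compact objects, so it matters that the
    colimit is compact as well. *)
Let cA : compact k U A := compact_small_colimit sk sQ sE cX un.

Let im (x y : Q) (e : E x y) : hom (i (X x)) (i (X y)) := fmap i (m e).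

Let compact_ex (B : C') (p : forall x, hom (i (X x)) B) :
  compact k U' B -> compatible im p -> exists h, forall x, h ∘ fmap i (n x) = p x.
Proof.
move=> /eso[B0 [cB [f [g [gf fg]]]]] cp.
have /dependent_choice[q qP] x : exists q, fmap i q = g ∘ p x.
  by have [b _ bK] := ff (@cX x) cB; exists (b (g ∘ p x)).
have cq : compatible m q.
  move=> x y e; apply: (bij_inj (ff (@cX x) cB)).
  by rewrite fmapM !qP -compmA cp.
have [h hP] := universal_ex un cq.
by exists (f ∘ fmap i h) => x; rewrite -compmA -fmapM hP qP compmA fg comp1m.
Qed.

Let compact_eq (B : C') (g h : hom (i A) B) :
  compact k U' B -> (forall x, g ∘ fmap i (n x) = h ∘ fmap i (n x)) -> g = h.
Proof.
move=> /eso[B0 [cB [s [t [ts st]]]]] gh.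
have [b _ bK] := ff cA cB.
suff tgh : b (t ∘ g) = b (t ∘ h).
  by rewrite -[g]comp1m -[h]comp1m -st -!compmA -[t ∘ g]bK tgh bK.
apply: universal_eq un _ => x; apply: (bij_inj (ff (@cX x) cB)).
by rewrite !fmapM !bK -!compmA gh.
Qed.

Lemma extension_small_colimit :
  universal (fun x y (e : E x y) => fmap i (m e)) (fun x => fmap i (n x)).
Proof.
have [_ _ [G [_ _ cG genG]]] := ext_target ext_i.
apply: universalI => [x y e|B p cp|B g h gh]; first by rewrite -fmapM un.1.
  have [J [D [c [sJ fJ DG cc cB]]]] := genG B; subst B.
  have fJ' := filtered_quiver sk fJ.
  have pX x : presented c (i (X x)).
    exact: compact_presented (ext_compact ext_i (@cX x)) cc.
  have [j [q [cq qP]]] := presented_stage sk fJ' sQ sE pX cp.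
  have [h hP] := compact_ex (cG _ (DG j)) cq.
  by exists (leg c j ∘ h) => x; rewrite -compmA hP qP.
have [J [D [c [sJ fJ DG cc cB]]]] := genG B; subst B.
have fJ' := filtered_quiver sk fJ.
have pr Y : compact k U Y -> presented c (i Y).
  by move=> cY; apply: compact_presented (ext_compact ext_i cY) cc.
(* Both maps lift to stages because [i A] is compact. At a later common stage the lifts agree after
   every [fmap i (n x)], hence are equal by the case of a compact target. *)
have [j [g' g'P]] := (pr _ cA).1 g; have [j' [h' h'P]] := (pr _ cA).1 h.
have [l0 [[u u']]] := filtered_join sk fJ' j j'.
have [||l [w wP]] := @equalized_stage _ _ sk fJ' _ _ c _ _ l0
  (fun x => fmap D u ∘ (g' ∘ fmap i (n x))) (fun x => fmap D u' ∘ (h' ∘ fmap i (n x))) sQ.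
- by move=> x; apply: (pr _ (@cX x)).2.
- by move=> x; rewrite !compmA !legP g'P h'P.
have : fmap D w ∘ (fmap D u ∘ g') = fmap D w ∘ (fmap D u' ∘ h').
  by apply: compact_eq (cG _ (DG l)) _ => x; rewrite -!compmA; apply: wP.
by move=> /(congr1 (fun f => leg c l ∘ f)); rewrite !compmA !legP g'P h'P.
Qed.

End ExtensionSmallColimit.

(** * Colimits as filtered colimits of small colimits *)

Section Subquivers.
Variables (k : V) (sk : small_sums k).
Variables (Q : Type) (E : Q -> Q -> Type).

(** Vertices and arrows are selected independently, and a selected arrow counts only when both
    endpoints are selected; unions can thus be formed componentwise. *)
Definition subquiver : Type :=
  {S : (Q -> Prop) * (arrow E -> Prop) |
    small_in k {x | S.1 x} /\ small_in k {a | S.2 a}}.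

Definition sq_vertex (S : subquiver) : Type := {x | (sval S).1 x}.

Definition sq_arrow (S : subquiver) (x y : sq_vertex S) : Type :=
  {e : E (sval x) (sval y) | (sval S).2 (existT _ _ (existT _ _ e))}.

Definition sq_sub (S S' : subquiver) : Prop :=
  (forall x, (sval S).1 x -> (sval S').1 x) /\
  (forall a, (sval S).2 a -> (sval S').2 a).

Definition subquivers : category := Category (@CatStructure subquiver sq_sub
  (fun S => conj (fun _ => id) (fun _ => id))
  (fun _ _ _ g f => conj (fun x Sx => g.1 x (f.1 x Sx)) (fun a Sa => g.2 a (f.2 a Sa)))
  (fun _ _ _ => Prop_irrelevance _ _) (fun _ _ _ => Prop_irrelevance _ _)
  (fun _ _ _ _ _ _ _ => Prop_irrelevance _ _)).

Lemma small_sq_arrow (S : subquiver) : small_in k (arrow (@sq_arrow S)).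
Proof.
case: S => S [sS1 sS2]; apply: small_arrow => // x y.
pose f (e : sq_arrow x y) : {a | S.2 a} :=
  exist S.2 (existT _ _ (existT _ _ (sval e))) (svalP e).
apply: (small_inj (f := f) _ sS2) => -[e Se] [e' Se'] /(congr1 sval) /= ee'.
by apply: eq_exist; apply: inj_pair2 (inj_pair2 _ _ _ _ _ ee').
Qed.

(** Inclusions form a preorder, so the componentwise union is automatically a cocone; closure of [k]
    under sums keeps it [k]-small. *)
Lemma subquivers_filtered : quiver_filtered k subquivers.
Proof.
move=> I F X m sI _.
pose S : (Q -> Prop) * (arrow E -> Prop) :=
  (fun x => exists t, (sval (X t)).1 x, fun a => exists t, (sval (X t)).2 a).
have sS1 : small_in k {x | S.1 x}.
  pose f (s : {t : I & {x | (sval (X t)).1 x}}) : {x | S.1 x} :=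
    exist S.1 (sval (projT2 s)) (ex_intro _ (projT1 s) (svalP (projT2 s))).
  apply: (small_surj (f := f)); last by apply: sk.2 => // t; case: (X t) => ? [].
  by move=> [x [t tx]]; exists (existT _ t (exist _ x tx)); apply: eq_exist.
have sS2 : small_in k {a | S.2 a}.
  pose f (s : {t : I & {a | (sval (X t)).2 a}}) : {a | S.2 a} :=
    exist S.2 (sval (projT2 s)) (ex_intro _ (projT1 s) (svalP (projT2 s))).
  apply: (small_surj (f := f)); last by apply: sk.2 => // t; case: (X t) => ? [].
  by move=> [x [t tx]]; exists (existT _ t (exist _ x tx)); apply: eq_exist.
exists (exist _ S (conj sS1 sS2)).
have n t : sq_sub (X t) (exist _ S (conj sS1 sS2)).
  by split=> y ty; exists t.
by exists n => t t' u; apply: (@Prop_irrelevance (sq_sub _ _)).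
Qed.

Lemma small_subquivers (U : V) :
  universe U -> small_in U Q -> small_in U (arrow E) -> small_category U subquivers.
Proof.
move=> uU sQ sE; have sU := universe_small_sums uU.
apply: small_arrow => // [|S S']; last exact: (small_Prop sU (sq_sub S S')).
apply: small_sig; apply: small_prod => //; exact: universe_small_pred.
Qed.

Lemma single_small : small_in k unit.
Proof. by apply: (@small_surj _ bool _ (fun=> tt) _ sk.1) => -[]; exists true. Qed.

Lemma sq_single_subproof (x : Q) :
  small_in k {z | eq x z} /\ small_in k {a : arrow E | False}.
Proof.
split; last by apply: small_void => // -[].
apply: (@small_surj _ unit _ (fun=> exist _ x erefl) _ single_small) => -[z xz].
by subst z; exists tt.
Qed.

(** One-vertex subquivers recover the legs of a cocone on the whole quiver, and one-arrow subquivers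
    recover its compatibility. *)
Definition sq_single (x : Q) : subquiver := exist _ (_, _) (sq_single_subproof x).

Lemma sq_edge_subproof (a : arrow E) :
  small_in k {z | projT1 a = z \/ projT1 (projT2 a) = z} /\ small_in k {b | a = b}.
Proof.
split.
  (* The two endpoints may coincide, so [bool] is only claimed to surject onto them. *)
  pose f (b : bool) : {z | projT1 a = z \/ projT1 (projT2 a) = z} :=
    if b then exist _ _ (or_introl erefl) else exist _ _ (or_intror erefl).
  apply: (small_surj (f := f) _ sk.1) => -[z [xz|yz]]; subst z.
    by exists true.
  by exists false; apply: eq_exist.
apply: (@small_surj _ unit _ (fun=> exist _ a erefl) _ single_small) => -[z xz].
by subst z; exists tt.
Qed.

Definition sq_edge (a : arrow E) : subquiver := exist _ (_, _) (sq_edge_subproof a).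

Lemma sq_single_sub (x : Q) (S : subquiver) : (sval S).1 x -> sq_sub (sq_single x) S.
Proof. by move=> Sx; split=> [z <-|]. Qed.

Variables (C : category) (X : Q -> C) (m : forall x y, E x y -> hom (X x) (X y)).

Definition sq_diagram (S : subquiver) (x y : sq_vertex S) (e : sq_arrow x y) :
  hom (X (sval x)) (X (sval y)) := m (sval e).

Variable (K : subquivers -> C).
Variable (l : forall (S : subquivers) (x : sq_vertex S), hom (X (sval x)) (K S)).
Hypothesis (ul : forall S, universal (@sq_diagram S) (@l S)).

Let sub_vertex (S S' : subquiver) (s : sq_sub S S') (x : sq_vertex S) : sq_vertex S' :=
  exist _ (sval x) (s.1 _ (svalP x)).

Let sub_compatible (S S' : subquiver) (s : sq_sub S S') :
  compatible (@sq_diagram S) (fun x => l (sub_vertex s x)).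
Proof.
move=> x y [e Se].
exact: (ul S').1 (sub_vertex s x) (sub_vertex s y) (exist _ e (s.2 _ Se)).
Qed.

Let K_map (S S' : subquivers) (s : hom S S') : hom (K S) (K S') :=
  sval (cid (universal_ex (ul S) (sub_compatible s))).

Let K_mapE (S S' : subquivers) (s : hom S S') (x : Q)
    (p : (sval S).1 x) (q : (sval S').1 x) :
  K_map s ∘ l (exist _ x p : sq_vertex S) = l (exist _ x q : sq_vertex S').
Proof.
pose v : sq_vertex S := exist _ x p.
rewrite (Prop_irrelevance q ((s : sq_sub S S').1 x (svalP v))) /K_map.
by case: cid => h /= hP; apply: (hP v).
Qed.

Let K_map1 (S : subquivers) : K_map (idm S) = idm (K S).
Proof.
by apply: universal_eq (ul S) _ => -[x Sx]; rewrite (K_mapE _ _ Sx) comp1m.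
Qed.

Let K_mapM (R S T : subquivers) (g : hom S T) (f : hom R S) :
  K_map (g ∘ f) = K_map g ∘ K_map f.
Proof.
apply: universal_eq (ul R) _ => -[x Rx].
have Sx := (f : sq_sub R S).1 x Rx; have Tx := (g : sq_sub S T).1 x Sx.
by rewrite -compmA (K_mapE f _ Sx) (K_mapE g _ Tx) (K_mapE _ _ Tx).
Qed.

Definition sq_functor : functor subquivers C := Functor K_map1 K_mapM.

Variables (A : C) (n : forall x, hom (X x) A).
Hypothesis un : universal m n.

Let n_compatible (S : subquivers) :
  compatible (@sq_diagram S) (fun x => n (sval x)).
Proof. by move=> x y e; apply: un.1. Qed.

Definition sq_leg (S : subquivers) : hom (K S) A :=
  sval (cid (universal_ex (ul S) (@n_compatible S))).

Lemma sq_legE (S : subquivers) (x : sq_vertex S) : sq_leg S ∘ l x = n (sval x).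
Proof. by rewrite /sq_leg; case: cid. Qed.

(** A cocone [p] over the subquivers is determined by its values at the one-vertex ones, and these
    form a cocone on the quiver itself. *)
Lemma universal_subquivers : universal (fmap sq_functor) sq_leg.
Proof.
apply: universalI => [S S' s|B p cp|B g h gh].
- apply: universal_eq (ul S) _ => -[x Sx]; have Sx' := (s : sq_sub S S').1 x Sx.
  rewrite -compmA (K_mapE s _ Sx') sq_legE.
  exact: (sq_legE (exist _ x Sx' : sq_vertex S')).
- pose v x : sq_vertex (sq_single x) := exist _ x erefl.
  have pE (S : subquivers) (x : sq_vertex S) :
      p S ∘ l x = p (sq_single (sval x)) ∘ l (v _).
    case: x => x Sx /=; rewrite -(cp _ _ (sq_single_sub Sx)) -compmA.
    by rewrite [_ ∘ l (v x)](K_mapE _ _ Sx).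
  have [x y e|h hP] := universal_ex (p := fun x => p (sq_single x) ∘ l (v x)) un.
    (* Both endpoint legs are moved into the subquiver made of [e] and its endpoints, where
       compatibility along [e] holds. *)
    pose a : arrow E := existT _ x (existT _ y e).
    pose vx : sq_vertex (sq_edge a) := exist _ x (or_introl erefl).
    pose vy : sq_vertex (sq_edge a) := exist _ y (or_intror erefl).
    rewrite -[LHS]/(_ ∘ m e) -(pE _ vx) -(pE _ vy) -compmA; congr (_ ∘ _).
    exact: (ul (sq_edge a)).1 vx vy (exist _ e erefl).
  exists h => S; apply: universal_eq (ul S) _ => x.
  by rewrite -compmA sq_legE hP (pE S x).
- apply: universal_eq un _ => x.
  by rewrite -(sq_legE (exist _ x erefl : sq_vertex (sq_single x))) !compmA gh.
Qed.

(** A cocone on the image of the quiver restricts to each subquiver and so induces maps out of every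
    [F (K S)]; these form a cocone, which factors through the preserved filtered colimit. *)
Lemma preserves_subquivers (C' : category) (F : functor C C') :
  (forall S, universal (fun x y (e : sq_arrow x y) => fmap F (sq_diagram e))
     (fun x => fmap F (@l S x))) ->
  universal (fmap (functor_comp F sq_functor)) (fun S => fmap F (sq_leg S)) ->
  universal (fun x y (e : E x y) => fmap F (m e)) (fun x => fmap F (n x)).
Proof.
move=> FS FP; apply: universalI => [x y e|B p cp|B g h gh].
- by rewrite -fmapM un.1.
- have cpS S : compatible (fun x y (e : sq_arrow x y) => fmap F (sq_diagram e))
      (fun x : sq_vertex S => p (sval x)) by move=> x y e; apply: cp.
  have /dependent_choice[q qP] S := universal_ex (FS S) (cpS S).
  have [S S' s|h hP] := universal_ex (p := q) FP.
    apply: universal_eq (FS S) _ => -[x Sx]; have Sx' := (s : sq_sub S S').1 x Sx.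
    rewrite -compmA -fmapM (K_mapE s _ Sx') qP.
    exact: (qP S' (exist _ x Sx' : sq_vertex S')).
  exists h => x; pose v : sq_vertex (sq_single x) := exist _ x erefl.
  by rewrite -(sq_legE v) fmapM compmA hP; apply: (qP _ v).
- apply: universal_eq FP _ => S; apply: universal_eq (FS S) _ => x.
  by rewrite -!compmA -fmapM sq_legE gh.
Qed.

End Subquivers.

(** * The comma quiver of a diagram *)

Section Comma.
Variables (k U : V) (C : setcat) (G : V).
Hypotheses (sk : small_sums k) (cG : forall A : C, El_val A ∈ G -> compact k U A).
Hypothesis genG : forall A : C, exists (J : setcat) (D : functor J C) (c : cocone D),
  [/\ small U J, filtered k J, forall j, El_val (D j) ∈ G, is_colimit c & apex c = A].

(** The last clause uses that generators are compact: a map from one into the filtered colimit [A]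
    factors through a leg. *)
Lemma generated (A : C) :
  exists (L : setcat) (X : functor L C) (w : forall l, hom (X l) A),
    [/\ small U L, filtered k L, forall l, El_val (X l) ∈ G, universal (fmap X) w &
        forall (Y : C) (f : hom Y A), El_val Y ∈ G -> exists l g, w l ∘ g = f].
Proof.
have [L [X [c [sL fL XG cc <-]]]] := genG A.
exists L, X, (leg c); split=> //; first exact/is_colimitE.
by move=> Y f /cG cY; apply: (compact_presented sk sL fL cY cc).1.
Qed.

Variables (J : category) (D : functor J C).

(** Sources are taken from [G] rather than from all compact objects, which keeps the quiver small
    when [G] is a member of [U]. *)
Definition comma : Type := {j : J & {A : {A : C | El_val A ∈ G} & hom (sval A) (D j)}}.

Definition comma_ob (x : comma) : C := sval (projT1 (projT2 x)).

Definition comma_map (x : comma) : hom (comma_ob x) (D (projT1 x)) := projT2 (projT2 x).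

Definition comma_hom (x y : comma) : Type :=
  {uh : hom (projT1 x) (projT1 y) * hom (comma_ob x) (comma_ob y) |
    fmap D uh.1 ∘ comma_map x = comma_map y ∘ uh.2}.

Definition comma_diagram (x y : comma) (e : comma_hom x y) :
  hom (comma_ob x) (comma_ob y) := (sval e).2.

Lemma small_comma : universe U -> locally_small U C -> G ∈ U ->
  small_category U J -> small_in U comma /\ small_in U (arrow comma_hom).
Proof.
move=> uU [_ _ homU] GU sJ; have sU := universe_small_sums uU.
have sC (A B : C) : small_in U (hom A B) by apply: small_El.
have sG : small_in U {A : C | El_val A ∈ G}.
  exists G => //; exists (fun A : {A : C | El_val A ∈ G} => to_El (svalP A)).
  move=> A B /(congr1 (@El_val _)) /= /El_inj; apply: eq_sig_hprop => ? ? ?.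
  exact: Prop_irrelevance.
have sc : small_in U comma.
  by apply: sU.2 => [|j]; [exact: small_objects|apply: sU.2 => // A; exact: sC].
split=> //; apply: small_arrow => // x y; apply: small_sig; apply: small_prod => //.
have := sJ.
apply: (small_inj (f := fun u : hom (projT1 x) (projT1 y) => existT _ _ (existT _ _ u))).
by move=> u v e; apply: inj_pair2 (inj_pair2 _ _ _ _ _ e).
Qed.

Variables (A : C) (n : forall j, hom (D j) A).

Definition comma_leg (x : comma) : hom (comma_ob x) A := n (projT1 x) ∘ comma_map x.

Definition to_comma (j : J) (B : C) (BG : El_val B ∈ G) (f : hom B (D j)) : comma :=
  existT _ j (existT _ (exist _ B BG) f).

Lemma comma_compatible :
  compatible (fmap D) n -> compatible comma_diagram comma_leg.
Proof.
move=> cn x y [[u h] /= uh].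
by rewrite /comma_leg /comma_diagram /= -compmA -uh compmA cn.
Qed.

(** At each [j], a compatible family on the comma quiver restricts to a cocone on a diagram of
    generators with colimit [D j]. The induced maps [q j] form a cocone on [D]. *)
Lemma universal_comma : universal (fmap D) n -> universal comma_diagram comma_leg.
Proof.
move=> un.
have D_eq j (B : C) (g h : hom (D j) B) :
    (forall (Y : C) (f : hom Y (D j)), El_val Y ∈ G -> g ∘ f = h ∘ f) -> g = h.
  move=> gh; have [L [X [w [_ _ XG uw _]]]] := generated (D j).
  by apply: universal_eq uw _ => l; apply: gh.
apply: universalI => [|B p cp|B g h gh]; first exact: comma_compatible un.1.
  have move_p j j' (u : hom j j') (Y Y' : C) (YG : El_val Y ∈ G) (YG' : El_val Y' ∈ G)
      (h : hom Y Y') (f : hom Y (D j)) (f' : hom Y' (D j')) :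
      fmap D u ∘ f = f' ∘ h -> p (to_comma YG' f') ∘ h = p (to_comma YG f).
    move=> uh.
    exact: (cp (to_comma YG f) (to_comma YG' f') (exist _ (u, h) uh)).
  have move_p1 j (Y Y' : C) (YG : El_val Y ∈ G) (YG' : El_val Y' ∈ G)
      (h : hom Y Y') (f' : hom Y' (D j)) :
      p (to_comma YG' f') ∘ h = p (to_comma YG (f' ∘ h)).
    by apply: (move_p _ _ (idm j)); rewrite fmap1 comp1m.
  have /dependent_choice[q qP] j : exists q : hom (D j) B,
      forall (Y : C) (YG : El_val Y ∈ G) (f : hom Y (D j)), q ∘ f = p (to_comma YG f).
    have [L [X [w [_ _ XG uw fw]]]] := generated (D j).
    have [|q qP] := @universal_ex _ _ _ _ _ _ _ w (fun l => p (to_comma (XG l) (w l))) uw.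
      by move=> l l' u; rewrite move_p1; congr (p (to_comma _ _)); apply: uw.1.
    (* The map [q] was prescribed only on the legs [w l], but every [f] from a generator factors
       through one of them. *)
    exists q => Y YG f; have [l [g <-]] := fw Y f YG.
    by rewrite compmA qP; apply: move_p1.
  have cq : compatible (fmap D) q.
    move=> j j' u; apply: D_eq => Y f YG.
    rewrite -compmA !(qP _ _ YG) -[LHS]compm1.
    by apply: (move_p _ _ u); rewrite compm1.
  have [h hP] := universal_ex un cq.
  exists h => -[j [[Y YG] f]].
  by rewrite /comma_leg /= compmA hP qP.
apply: universal_eq un _ => j; apply: D_eq => Y f YG.
by have := gh (to_comma YG f); rewrite /comma_leg /= !compmA.
Qed.

(** Maps out of [F (D j)] are detected on images of generators, because [F] preserves the filtered
    colimit presenting [D j]. Cocones on [F D] can then be compared through the comma quiver. *)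
Lemma preserves_comma (C' : category) (F : functor C C') :
  (forall (L : setcat) (X : functor L C),
    small U L -> filtered k L -> preserves_colimit F X) ->
  compatible (fmap D) n ->
  universal (fun x y (e : comma_hom x y) => fmap F (comma_diagram e))
    (fun x => fmap F (comma_leg x)) ->
  universal (fmap (functor_comp F D)) (fun j => fmap F (n j)).
Proof.
move=> pF cn un.
have FD_eq j (B : C') (g h : hom (F (D j)) B) :
    (forall (Y : C) (f : hom Y (D j)), El_val Y ∈ G -> g ∘ fmap F f = h ∘ fmap F f) ->
    g = h.
  move=> gh; have [L [X [w [sL fL XG uw _]]]] := generated (D j).
  have cc : is_colimit (Cocone uw.1) by apply/is_colimitE.
  have /is_colimitE uF := pF _ _ sL fL _ cc.
  by apply: universal_eq uF _ => l; apply: gh.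
apply: universalI => [j j' u|B p cp|B g h gh].
- by rewrite /= -fmapM cn.
- have [|h hP] := universal_ex (p := fun x => p (projT1 x) ∘ fmap F (comma_map x)) un.
    move=> x y [[u h] /= uh].
    by rewrite /comma_diagram /= -compmA -fmapM -uh fmapM compmA cp.
  exists h => j; apply: FD_eq => Y f YG.
  by have := hP (to_comma YG f); rewrite /comma_leg /= fmapM compmA.
- apply: universal_eq un _ => x.
  by rewrite /comma_leg fmapM !compmA gh.
Qed.

End Comma.

(** * Preservation of small colimits by an accessible extension *)

Theorem proposition3p9 (kappa U U' : V)
    (regular_kappa : regular_cardinal kappa)
    (universe_U : universe U) (kappa_in_U : kappa ∈ U)
    (universe_U' : universe U') (U_sub_U' : U ⊆ U')
    (C C' : setcat) (i : functor C C')
    (ext_i : accessible_extension kappa U U' i)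
    (presentable_C : locally_presentable kappa U C) :
  forall (J : setcat) (D : functor J C),
    small U J -> preserves_colimit i D.
Proof.
move=> J D sJ c /is_colimitE uc; apply/is_colimitE.
have sk := regular_small_sums regular_kappa.
have [[lC _ [G [GU _ cG genG]]] colC] := presentable_C.
have [_ pres_i] := ext_functor ext_i.
have [sQ sE] := small_comma D universe_U lC GU (small_category_of_small sJ).
have uQ := universal_comma sk cG genG uc.
(* Pass to the comma quiver, all of whose vertices are sent to compact objects. *)
apply: (preserves_comma sk cG genG pres_i (compatible_leg c)).
have sSv (S : subquivers kappa (@comma_hom C G J D)) : small_in kappa (sq_vertex S).
  by case: S => S [].
pose m S := sq_diagram (k := kappa) (@comma_diagram C G J D) (S := S).
(* Since [kappa] is a member of [U], a [kappa]-small subquiver is [U]-small, and cocompleteness of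
   [C] supplies its colimit. *)
have colS S : exists K : {A : C & forall x : sq_vertex S, hom (comma_ob (sval x)) A},
    universal (m S) (projT2 K).
  have kU := small_trans universe_U.1 kappa_in_U.
  have [A [n un]] := has_quiver_colimit universe_U colC
    (m S) (kU _ (sSv S)) (kU _ (small_sq_arrow sk S)).
  by exists (existT _ A n).
have [K KP] := dependent_choice colS.
have ul S : universal (m S) ((fun S => projT2 (K S)) S) := KP S.
(* Two claims remain: [i] preserves the colimit of each subquiver, whose vertices are compact, and
   the filtered colimit of the [K S]. *)
apply: (preserves_subquivers (ul := ul) (un := uQ) sk).
  move=> S.
  apply: (extension_small_colimit sk ext_i (sSv S) (small_sq_arrow sk S) _ (KP S)).
  by move=> x; apply: cG; apply: (svalP (projT1 (projT2 (sval x)))).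
apply: (preserves_filtered_universal universe_U sk pres_i).
- exact: small_subquivers.
- exact: subquivers_filtered.
- exact: universal_subquivers.
Qed.
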